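(* Let $G=(V,E,\omega)$ be an infinite weighted graph as in the context, let $p>1$, $q>0$, and suppose $q(p-1)>1$. Assume that $G$ satisfies the Faber--Krahn inequality for $p$ with a function $\Lambda_p$ (with the properties in the context). Let $u_0\in\ell^1(V)$ be nonnegative, not identically zero, and have its support contained in a ball $B_{R_0}$, and let $u\in L^\infty([0,T);\ell^1(V))$ be a solution of $$\begin{cases}\partial_t u(x,t)=\Delta_p u^q(x,t), & x\in V,\ t>0,\\ u(x,0)=u_0(x), & x\in V.\end{cases}$$ Then for every $0<\varepsilon<1$ there exists a constant $c>0$ such that, for $0<t<T$, $$\|u(t)\|_{\ell^1(B_R)}\ge(1-\varepsilon)\|u_0\|_{\ell^1(V)}$$ whenever $$R\ge\max\left\{\frac{c}{\varepsilon}\,t^{1/p}\,\|u_0\|_{\ell^1(V)}^{\frac{q(p-1)-1}{p}}\;\varphi_1\!\Big(t^{-1}\|u_0\|_{\ell^1(V)}^{-[q(p-1)-1]}\Big)^{\frac{q(p-1)-1}{p}},\;2R_0\right\}.$$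
   Context: Graph: $G=(V,E,\omega)$ is an infinite, connected, countable weighted graph with no multiple edges or self-loops; $\omega:V\times V\to[0,\infty)$ is symmetric and $\omega_{xy}=\omega(x,y)>0$ if and only if $\{x,y\}\in E$ (written $x\sim y$). Every vertex has finite degree, $\mu(x)=\sum_{y\sim x}\omega_{xy}$, and $\mu_0:=\inf_{x\in V}\mu(x)>0$. $\mu_V(U)=\sum_{x\in U}\mu(x)$ for $U\subset V$. $d(x,y)$ is the graph distance, $B_R(x_0)=\{x\in V:d(x,x_0)\le R\}$; a center $x_0\in V$ is fixed and $B_R=B_R(x_0)$ for all radii. Norms: $\|f\|_{\ell^r(U)}=\big(\sum_{x\in U}|f(x)|^r\mu(x)\big)^{1/r}$ for $r\ge1$, $U\subset V$; $u(t)=u(\cdot,t)$. Powers: for $k\in\mathbb R$, $s>0$, $k^s:=|k|^{s-1}k$ (so $0^s=0$). Operator: $\Delta_p u^q(x,t)=\frac1{\mu(x)}\sum_{y\in V}|u^q(y,t)-u^q(x,t)|^{p-2}(u^q(y,t)-u^q(x,t))\,\omega_{xy}$. Solution: a solution in $L^\infty([0,T);\ell^1(V))$ ($0<T\le+\infty$) is a function $u:V\times[0,T)\to\mathbb R$ with $u\in L^\infty([0,T);\ell^1(V))$, $u(x,\cdot)\in C^1([0,T))$ for all $x\in V$, satisfying the initial value problem pointwise (for $0<t<T$). Faber--Krahn inequality: $G$ satisfies the Faber--Krahn inequality for $p>1$ and a function $\Lambda_p:(0,+\infty)\to(0,+\infty)$ if for every finite $U\subset V$ and every $f:V\to\mathbb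 R$ vanishing outside $U$, $$\Lambda_p(\mu_V(U))\sum_{x\in V}|f(x)|^p\mu(x)\le\sum_{x,y\in V}|f(y)-f(x)|^p\,\omega_{xy}.$$ It is always assumed that $\Lambda_p$ is continuous and decreasing, and that there exist constants $N>0$ and $\nu$ such that on $(0,\infty)$ the function $v\mapsto\Lambda_p(v)^{-1}v^{-p/N}$ is nondecreasing and $v\mapsto\Lambda_p(v)^{-1}v^{-\nu}$ is nonincreasing. The function $\varphi_1$: $\psi_1(s):=s^{q(p-1)-1}\Lambda_p(s^{-1})$, $s>0$. When $q(p-1)>1$, $\psi_1$ is a continuous strictly increasing bijection of $(0,+\infty)$ onto itself, and $\varphi_1$ denotes its inverse. *)

(* Defs.v *)
From mathcomp Require Export all_boot all_order all_algebra.
From mathcomp Require Export all_classical all_reals all_analysis.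
Export Order.TTheory GRing.Theory Num.Theory.
Export numFieldNormedType.Exports.

Set Implicit Arguments.
Unset Strict Implicit.
Unset Printing Implicit Defensive.

Local Open Scope classical_set_scope.
Local Open Scope ring_scope.

Section Graphs.
Context {R : realType} {V : countType}.

Definition neighbors (w : V -> V -> R) (x : V) : set V := [set y | 0 < w x y].

Definition vertex_weight (w : V -> V -> R) (x : V) : R :=
  \sum_(y \in neighbors w x) w x y.

Definition has_walk (w : V -> V -> R) (x y : V) (n : nat) : Prop :=
  exists s : seq V,
    [/\ path (fun a b => 0 < w a b) x s, last x s = y & size s = n].

End Graphs.

(* The edges are the pairs of positive weight; in particular there are no
   multiple edges. *)
Record wgraph (R : realType) (V : countType) := WGraph {
  weight :> V -> V -> R ;
  weight_ge0 : forall x y, 0 <= weight x y ;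
  weight_sym : forall x y, weight x y = weight y x ;
  weight_noloop : forall x, weight x x = 0 ;
  graph_infinite : infinite_set [set: V] ;
  graph_connected : forall x y, exists n, `[< has_walk weight x y n >] ;
  graph_locally_finite : forall x, finite_set (neighbors weight x) ;
  vertex_weight_inf : 0 < inf (range (vertex_weight weight))
}.

Section Definitions.
Context {R : realType} {V : countType} (G : wgraph R V).

Definition mu (x : V) : R := vertex_weight G x.

Definition muV (U : set V) : R := \sum_(x \in U) mu x.

Definition gdist (x y : V) : nat := ex_minn (graph_connected G x y).

Definition gball (x0 : V) (r : R) : set V :=
  [set x | (gdist x x0)%:R <= r].

Definition lnorm (r : R) (U : set V) (f : V -> R) : \bar R :=
  ((\esum_(x in U) (`|f x| `^ r * mu x)%:E) `^ r^-1)%E.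

(* For k = 0 this is 0, whatever s is. *)
Definition spow (k s : R) : R := `|k| `^ (s - 1) * k.

(* The sum has finite support: its terms vanish unless y is a neighbor of x. *)
Definition plaplacian (p : R) (f : V -> R) (x : V) : R :=
  (mu x)^-1 *
  \sum_(y \in [set: V]) `|f y - f x| `^ (p - 2) * (f y - f x) * G x y.

Definition time_interval (T : \bar R) : set R :=
  [set t | 0 <= t /\ (t%:E < T)%E].

(* Derivatives are relative to I, hence one-sided at an endpoint of I. *)
Definition C1_on (I : set R) (f : R -> R) : Prop :=
  exists2 g : R -> R, {within I, continuous g} &
    forall t, I t ->
      (fun s => (f s - f t) / (s - t)) @ within I (t^') --> g t.

(* As l^1(V) is separable, strong measurability of t |-> u(t) amounts to the
   measurability of its coordinates. *)
Definition Linfty_l1 (I : set R) (u : V -> R -> R) : Prop :=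
  (forall x, measurable_fun I (u x)) /\
  exists M : R,
    {ae @lebesgue_measure R,
      forall t, I t -> (lnorm 1 [set: V] (u^~ t) <= M%:E)%E}.

Definition is_solution (p q : R) (T : \bar R) (u0 : V -> R)
    (u : V -> R -> R) : Prop :=
  [/\ Linfty_l1 (time_interval T) u,
      forall x, C1_on (time_interval T) (u x),
      forall x t, 0 < t -> (t%:E < T)%E ->
        is_derive t 1 (u x) (plaplacian p (fun y => spow (u y t) q) x)
    & forall x, u x 0 = u0 x].

Definition faber_krahn (p : R) (Lam : R -> R) : Prop :=
  forall (U : set V) (f : V -> R),
    finite_set U -> (forall x, ~ U x -> f x = 0) ->
    ((Lam (muV U))%:E * (\esum_(x in [set: V]) (`|f x| `^ p * mu x)%:E) <=
     \esum_(z in [set: V * V])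
        (`|f z.2 - f z.1| `^ p * G z.1 z.2)%:E)%E.

End Definitions.

Definition FK_function {R : realType} (p : R) (Lam : R -> R) : Prop :=
  [/\ {in `]0, +oo[, forall v, 0 < Lam v},
      {in `]0, +oo[, continuous Lam},
      {in `]0, +oo[ &, {homo Lam : v w /~ v < w}}
    & exists N nu : R,
        [/\ 0 < N,
            {in `]0, +oo[ &, {homo (fun v => (Lam v)^-1 * v `^ (- (p / N))) :
               v w / v <= w}}
          & {in `]0, +oo[ &, {homo (fun v => (Lam v)^-1 * v `^ (- nu)) :
               v w /~ v <= w}}]].

Definition psi1 {R : realType} (p q : R) (Lam : R -> R) (s : R) : R :=
  s `^ (q * (p - 1) - 1) * Lam s^-1.

(* The inverse of psi1 as a map from ]0, +oo[ to itself. *)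
Definition phi1 {R : realType} (p q : R) (Lam : R -> R) : R -> R :=
  pinv (`]0, +oo[ : set R) (psi1 p q Lam).

(* Main.v *)
From mathcomp Require Import finmap ring lra.
Require Import Defs.

(** Write [a = q * (p - 1) - 1], [th = a / p], [m] for the mass of [u0] and
[s t = phi1 p q Lam (t^-1 * m `^ (- a))].  The threshold on the radius is a
multiple of [t `^ p^-1 * s t `^ th], the distance reached by diffusion at time
[t]; the theorem says that little mass leaves a ball that is large on this
scale.

Test the equation with the function [plateau r], which is 1 on the ball of
radius [r / 2], vanishes outside the ball of radius [r], and changes by at
most [2 / r] along an edge.  The mass lost up to time [t] is then at most
[1 / r] times the time integral of the total flux, the sum of
[X `^ (p - 1) * w] over the edges, where [X] is the increment of [u^q].  So
everything reduces to showing that this integral is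
[O(t `^ p^-1 * s t `^ th)].

Let [Z] be the increment of [u^th] along an edge and [Y] the moment
[\sum_x `|u x| `^ (1 + th) * mu x].  Testing the equation with [u^th] shows
that [X `^ (p - 1) * Z] is the density of the dissipation [- Y'].  The
pointwise inequality [flux_le],
  [X `^ (p - 1) <= la * X `^ (p - 1) * Z
                   + C * la `^ (1 - p) * (|u x| `^ (1 + th) + |u y| `^ (1 + th))],
bounds the flux by the dissipation and the moment itself; [th = a / p] is the
one exponent for which the same moment appears in both roles.  With
[la = tau `^ p^-1] the flux at time [tau] is at most
[- tau `^ p^-1 * Y' + C * tau `^ (p^-1 - 1) * Y].  Hence it suffices that
[Y tau = O(s tau `^ th)] ([power_sum_decay]) and that
[tau `^ (p^-1 - 1) * s tau `^ th] is integrable near 0 with the right integral.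
The latter holds because [s] decays strictly slower than [t `^ (- a^-1)]
([phi1_decay]); this is where the power bound on [Lam] enters ([mass_loss]).

The decay of [Y] is a Nash argument.  For a level [k > 0] the Faber-Krahn
inequality is applied to the truncation of [`|u| `^ ga] at height [k `^ ga],
[ga = (q * (p - 1) + th) / p], whose support has measure at most [M / k] where
[M] bounds the l^1 norm of [u].  By the Stroock-Varopoulos inequality the
gradient energy of [`|u| `^ ga] is controlled by the dissipation, which gives
[nash_le].  Choosing [k] in terms of [Y] yields the differential inequality
[Y' <= - c * Y `^ (1 + p) * Lam (M / k)], and [ode_decay] integrates it.

Two devices keep all sums finite and avoid integrals in time.  The moment and
the dissipation carry a finitely supported weight [cutoff n], whose increments
along edges are at most [p / n]; since [1 < q * (p - 1)] and [u] is bounded,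
this costs errors [O(1 / n)], removed by letting [n] tend to infinity at
fixed [t].  Integration in time is replaced by the monotonicity of an explicit
function with nonnegative derivative ([derive_ge0_le]).  The estimates involve
only [`|u|] and odd powers of [u], so that no comparison principle enters; the
constant obtained for the theorem depends on the solution through [M]
and [m]. *)

Set Implicit Arguments.
Unset Strict Implicit.
Unset Printing Implicit Defensive.

Local Open Scope classical_set_scope.
Local Open Scope ring_scope.

(** * Inequalities between powers *)

Section Powers.
Context {R : realType}.
Implicit Types (a b r s : R).

(** Unlike [powRD] this allows the base 0, where it holds because at least one
of the exponents is nonzero. *)
Lemma powR_mul_add a r s : 0 <= a -> 0 < r + s -> a `^ r * a `^ s = a `^ (r + s).
Proof.
move=> a0 rs0; have [->|an0] := eqVneq a 0.
  rewrite [in RHS]powR0 ?gt_eqF//.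
  have [r0|r0] := eqVneq r 0; last by rewrite powR0// mul0r.
  by move: rs0; rewrite r0 add0r => s0; rewrite [X in _ * X]powR0 ?mulr0// gt_eqF.
by rewrite powRD// an0 implybT.
Qed.

(** Young's inequality for the product [r * 1] with the conjugate exponents [s]
and [s / (s - 1)]. *)
Lemma bernoulli_powR r s : 0 <= r -> 1 <= s -> 1 - r `^ s <= s * (1 - r).
Proof.
move=> r0; rewrite le_eqVlt => /predU1P[<-|s1].
  by rewrite powRr1// mul1r.
have s0 : 0 < s by lra.
have := @conjugate_powR _ r 1 s (s / (s - 1)) r0 ler01 s0.
rewrite powR1 mulr1 invf_div => H.
have /H{H} : 0 < s / (s - 1) by rewrite divr_gt0//; lra.
have -> : s^-1 + (s - 1) / s = 1 by field; lra.
move=> /(_ erefl) /(ler_wpM2l (ltW s0)).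
have -> : s * (r `^ s / s + 1 * ((s - 1) / s)) = r `^ s + s - 1 by field; lra.
lra.
Qed.

(** A mean value inequality with an endpoint in place of the intermediate point:
dividing by [a `^ s] it becomes Bernoulli's inequality for [(b / a) `^ r]. *)
Lemma powR_sub_le r s a b : 0 <= b -> b <= a -> 0 < r -> r <= s ->
  a `^ s - b `^ s <= (s / r) * (a `^ (s - r) * (a `^ r - b `^ r)).
Proof.
move=> b0 ba r0 rs; have s0 : 0 < s by lra.
have := ba; rewrite le_eqVlt => /predU1P[->|ba']; first by rewrite !subrr !mulr0.
have a0 : 0 < a by lra.
have [x x0 ->] : exists2 x, 0 <= x & b = a * x.
  by exists (b / a); [rewrite divr_ge0// ltW|field; lra].
rewrite !powRM// ?(ltW a0)//.
have -> : a `^ s = a `^ (s - r) * a `^ r by rewrite powR_mul_add ?subrK ?ltW.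
have B : 1 - x `^ s <= (s / r) * (1 - x `^ r).
  have -> : x `^ s = (x `^ r) `^ (s / r) by rewrite -powRrM; congr (_ `^ _); field; lra.
  by apply: bernoulli_powR; [exact: powR_ge0|rewrite ler_pdivlMr// mul1r].
have := ler_wpM2l (mulr_ge0 (powR_ge0 a (s - r)) (powR_ge0 a r)) B.
by congr (_ <= _); ring.
Qed.

Lemma powR_sub_ge r s a b : 0 <= b -> b <= a -> 0 < r -> r <= s ->
  a `^ (s - r) * (a `^ r - b `^ r) <= a `^ s - b `^ s.
Proof.
move=> b0 ba r0 rs; have a0 : 0 <= a by lra.
rewrite mulrBr powR_mul_add ?subrK//; last by lra.
rewrite lerD2l lerN2.
have -> : b `^ s = b `^ (s - r) * b `^ r by rewrite powR_mul_add ?subrK//; lra.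
by apply: ler_wpM2r; [exact: powR_ge0|rewrite ge0_ler_powR ?nnegrE// subr_ge0].
Qed.

Lemma spow_ge0E r a : 0 < r -> 0 <= a -> spow a r = a `^ r.
Proof. by move=> r0 a0; rewrite /spow ger0_norm// mulrC mulr_powRB1. Qed.

Lemma spowN r a : spow (- a) r = - spow a r.
Proof. by rewrite /spow normrN mulrN. Qed.

Lemma normr_spow r a : 0 < r -> `|spow a r| = `|a| `^ r.
Proof.
move=> r0; rewrite /spow normrM (ger0_norm (powR_ge0 _ _)) mulrC.
by rewrite mulr_powRB1.
Qed.

Lemma spow_homo r : 0 < r -> {homo (fun a => spow a r) : a b / a <= b}.
Proof.
move=> r0.
have pos a b : 0 <= a -> a <= b -> spow a r <= spow b r.
  move=> a0 ab; rewrite !spow_ge0E//; last by lra.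
  by rewrite ge0_ler_powR ?nnegrE//; lra.
move=> a b ab; have [a0|a0] := leP 0 a; first exact: pos.
have [b0|b0] := leP 0 b.
  apply: (@le_trans _ _ 0); last by rewrite spow_ge0E ?powR_ge0.
  by rewrite -[a]opprK spowN spow_ge0E ?oppr_le0 ?powR_ge0//; lra.
by rewrite -[a]opprK -[b]opprK (spowN r (- a)) (spowN r (- b)) lerN2; apply: pos; lra.
Qed.

Lemma spow_sub_mul_ge0 r s a b : 0 < r -> 0 < s ->
  0 <= (spow a r - spow b r) * (spow a s - spow b s).
Proof.
move=> r0 s0; have [ab|ab] := leP b a.
  by rewrite mulr_ge0// subr_ge0; exact: spow_homo.
have {}ab := ltW ab.
by rewrite mulr_le0// subr_le0; exact: spow_homo.
Qed.

(** A property of pairs that is invariant under exchange and under a common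
change of sign only needs to be checked when the first entry is nonnegative
and dominates the second in absolute value. *)
Lemma signed_pair_ind (P : R -> R -> Prop) :
  (forall a b, P a b -> P b a) -> (forall a b, P a b -> P (- a) (- b)) ->
  (forall a b, `|b| <= a -> P a b) -> forall a b, P a b.
Proof.
move=> sym opp base.
have main a b : `|b| <= `|a| -> P a b.
  have [a0 ba|a0 ba] := leP 0 a; first by apply: base; rewrite -(ger0_norm a0).
  rewrite -[a]opprK -[b]opprK; apply/opp/base.
  by rewrite normrN -(ltr0_norm a0).
by move=> a b; have [|/ltW] := leP `|b| `|a|; [exact: main|move/main/sym].
Qed.

(** For entries of equal sign this is [powR_sub_le].  For opposite signs both
increments are comparable to the corresponding power of the larger entry; this
case accounts for the factor 2. *)
Lemma spow_sub_le r s a b : 0 < r -> r <= s ->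
  `|spow a s - spow b s| <=
  2 * (s / r) * (Num.max `|a| `|b| `^ (s - r) * `|spow a r - spow b r|).
Proof.
move=> r0 rs; have s0 : 0 < s by lra.
have sr1 : 1 <= s / r by rewrite ler_pdivlMr// mul1r.
move: a b; apply: signed_pair_ind => [a b H|a b H|a b ba].
- by rewrite maxC (distrC (spow b s)) (distrC (spow b r)).
- by rewrite !spowN !normrN -!opprD !normrN.
have a0 : 0 <= a by apply: le_trans ba.
rewrite (ger0_norm a0) (max_idPl ba).
have [b0|b0] := leP 0 b.
  move: ba; rewrite (ger0_norm b0) => ba.
  have ge t : 0 < t -> b `^ t <= a `^ t.
    by move=> t0; rewrite ge0_ler_powR ?nnegrE// ltW.
  rewrite !spow_ge0E// !ger0_norm ?subr_ge0 ?ge//.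
  apply: le_trans (powR_sub_le b0 ba r0 rs) _; rewrite -[leRHS]mulrA ler_peMl ?ler1n//.
  by rewrite !mulr_ge0 ?powR_ge0 ?subr_ge0 ?ge ?invr_ge0// ltW.
rewrite -{1 2}[b]opprK !(spowN _ (- b)) !opprK.
move: ba; rewrite (ltr0_norm b0); set b' := - b => ba.
have b'0 : 0 <= b' by rewrite /b'; lra.
rewrite !spow_ge0E// !ger0_norm ?addr_ge0 ?powR_ge0//.
apply: (@le_trans _ _ (2 * a `^ s)).
  rewrite mulr_natl mulr2n lerD2l ge0_ler_powR ?nnegrE//; exact: ltW.
apply: (@le_trans _ _ (2 * (a `^ (s - r) * a `^ r))).
  by rewrite powR_mul_add ?subrK.
rewrite -[leRHS]mulrA ler_pM2l//; apply: (@le_trans _ _ (a `^ (s - r) * (a `^ r + b' `^ r))).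
  by rewrite ler_wpM2l ?powR_ge0// lerDl powR_ge0.
by rewrite ler_peMl// mulr_ge0 ?addr_ge0 ?powR_ge0.
Qed.

Lemma norm_powR_sub_le r a b : 0 < r ->
  `| `|a| `^ r - `|b| `^ r| <= `|spow a r - spow b r|.
Proof. by move=> r0; rewrite -!normr_spow//; exact: ler_dist_dist. Qed.

(** Since [ga] lies between [th] and [q], the increment of the power [ga] is at
most a power of the larger entry times the increment of either of the other
powers.  Using the bound by the power [q] for [p - 1] of the [p] factors and
the bound by the power [th] for the last one, the powers of the larger entry
cancel, by the relation between [p], [q], [th] and [ga]. *)
Lemma stroock_varopoulos (p q th ga a b : R) : 1 < p -> 0 < th -> th <= ga ->
  ga <= q -> p * ga = q * (p - 1) + th ->
  `| `|a| `^ ga - `|b| `^ ga| `^ p <=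
  (ga / th) * (`|spow a q - spow b q| `^ (p - 1) * `|spow a th - spow b th|).
Proof.
move=> p1 th0 thga gaq gaE.
have q0 : 0 < q by lra. have ga0 : 0 < ga by lra.
suff H (A B : R) : 0 <= B -> B <= A -> (A `^ ga - B `^ ga) `^ p <=
    (ga / th) * ((A `^ q - B `^ q) `^ (p - 1) * (A `^ th - B `^ th)).
  apply: (@le_trans _ _ ((ga / th) * (`| `|a| `^ q - `|b| `^ q| `^ (p - 1) *
      `| `|a| `^ th - `|b| `^ th|))); last first.
    rewrite ler_wpM2l ?divr_ge0 ?(ltW ga0) ?(ltW th0)//.
    rewrite ler_pM ?powR_ge0 ?normr_ge0 ?norm_powR_sub_le//.
    by rewrite ge0_ler_powR ?nnegrE ?norm_powR_sub_le//; lra.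
  have ge (t A B : R) : 0 < t -> 0 <= B -> B <= A -> 0 <= A `^ t - B `^ t.
    by move=> t0 B0 BA; rewrite subr_ge0 ge0_ler_powR ?nnegrE//; lra.
  have [ba|/ltW ab] := leP `|b| `|a|.
    by have := H _ _ (normr_ge0 b) ba;
      rewrite !(fun t t0 => ger0_norm (ge t _ _ t0 (normr_ge0 b) ba)).
  rewrite (distrC (_ `^ ga)) (distrC (_ `^ q)) (distrC (_ `^ th)).
  by have := H _ _ (normr_ge0 a) ab;
    rewrite !(fun t t0 => ger0_norm (ge t _ _ t0 (normr_ge0 a) ab)).
move=> B0; rewrite le_eqVlt => /predU1P[->|BA].
  by rewrite !subrr powR0 ?mulr0//; lra.
have A0 : 0 < A by lra.
have ge t : 0 < t -> 0 <= A `^ t - B `^ t.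
  by move=> t0; rewrite subr_ge0 ge0_ler_powR ?nnegrE//; lra.
have -> : (A `^ ga - B `^ ga) `^ p =
    (A `^ ga - B `^ ga) `^ (p - 1) * (A `^ ga - B `^ ga).
  by rewrite mulrC mulr_powRB1 ?ge//; lra.
have Hga : A `^ ga - B `^ ga <= A `^ (ga - q) * (A `^ q - B `^ q).
  have := powR_sub_ge B0 (ltW BA) ga0 gaq.
  rewrite -(@ler_pM2l _ (A `^ (ga - q))) ?powR_gt0// mulrA -powRD ?(gt_eqF A0) ?implybT//.
  by rewrite (_ : ga - q + (q - ga) = 0) ?powRr0 ?mul1r//; ring.
have Hth := powR_sub_le B0 (ltW BA) th0 thga.
have Hp : (A `^ ga - B `^ ga) `^ (p - 1) <=
    A `^ ((ga - q) * (p - 1)) * (A `^ q - B `^ q) `^ (p - 1).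
  rewrite powRrM -powRM ?powR_ge0 ?ge//.
  apply: (ge0_ler_powR _ _ _ Hga); rewrite ?nnegrE; [lra|exact: ge|].
  by rewrite mulr_ge0 ?powR_ge0 ?ge.
apply: le_trans (ler_pM (powR_ge0 _ _) (ge _ ga0) Hp Hth) _.
rewrite le_eqVlt; apply/orP; left; apply/eqP.
set X := _ `^ (p - 1); set Z := A `^ th - _.
transitivity (ga / th * (A `^ ((ga - q) * (p - 1)) * A `^ (ga - th)) * X * Z); first ring.
rewrite -powRD ?(gt_eqF A0) ?implybT//.
rewrite (_ : _ + _ = 0) ?powRr0; first by ring.
nra.
Qed.

(** Either [la] times the increment of the power [th] is at least 1, and the
first term alone suffices, or this increment is less than [la^-1], and
[spow_sub_le] turns this into a bound for the increment of the power [q]. *)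
Lemma flux_le (p q th la a b : R) : 1 < p -> 0 < th -> th <= q -> 0 < la ->
  0 < (q - th) * (p - 1) ->
  `|spow a q - spow b q| `^ (p - 1) <=
  la * (`|spow a q - spow b q| `^ (p - 1) * `|spow a th - spow b th|) +
  (2 * (q / th)) `^ (p - 1) * (la `^ (1 - p) *
    (`|a| `^ ((q - th) * (p - 1)) + `|b| `^ ((q - th) * (p - 1)))).
Proof.
move=> p1 th0 thq la0 e0.
set X := `|_| `^ (p - 1); set Z := `|spow a th - spow b th|.
have X0 : 0 <= X by exact: powR_ge0.
have [laZ|laZ] := leP 1 (la * Z).
  rewrite -[leLHS]addr0 lerD//; last first.
    by rewrite !mulr_ge0 ?addr_ge0 ?powR_ge0.
  by rewrite mulrCA ler_peMr.
rewrite -[leLHS]add0r lerD ?(mulr_ge0 (ltW la0) (mulr_ge0 X0 (normr_ge0 _)))//.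
have C0 : 0 <= 2 * (q / th) by rewrite mulr_ge0// divr_ge0//; lra.
have m0 : 0 <= Num.max `|a| `|b| by rewrite le_max normr_ge0.
have ZL : Z <= la^-1 by rewrite -[leRHS]mul1r ler_pdivlMr// mulrC ltW.
apply: (@le_trans _ _ ((2 * (q / th) * (Num.max `|a| `|b| `^ (q - th) * Z)) `^ (p - 1))).
  apply: (ge0_ler_powR _ _ _ (spow_sub_le a b th0 thq)); rewrite ?nnegrE//.
    by lra.
  by rewrite !mulr_ge0 ?powR_ge0 ?invr_ge0//; lra.
rewrite [leLHS]powRM//; last by rewrite mulr_ge0 ?powR_ge0 ?normr_ge0.
rewrite ler_wpM2l ?powR_ge0//.
rewrite powRM ?powR_ge0 ?normr_ge0// mulrC -powRrM.
apply: ler_pM; rewrite ?powR_ge0//.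
  have -> : la `^ (1 - p) = (la^-1) `^ (p - 1).
    by rewrite -powR_inv1 ?(ltW la0)// -powRrM; congr (_ `^ _); ring.
  by apply: (ge0_ler_powR _ _ _ ZL); rewrite ?nnegrE ?invr_ge0 ?normr_ge0 ?subr_ge0 ?ltW.
by rewrite /Num.max; case: ifP => _; rewrite ?lerDl ?lerDr powR_ge0.
Qed.

Lemma flux_le_max (p q a b : R) : 1 < p -> 0 < q ->
  `|spow a q - spow b q| `^ (p - 1) <=
  2 `^ (p - 1) * (`|a| `^ (q * (p - 1)) + `|b| `^ (q * (p - 1))).
Proof.
move=> p1 q0.
have m0 : 0 <= Num.max `|a| `|b| by rewrite le_max normr_ge0.
apply: (@le_trans _ _ ((2 * Num.max `|a| `|b| `^ q) `^ (p - 1))).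
  rewrite ge0_ler_powR ?nnegrE ?mulr_ge0 ?powR_ge0//; first by lra.
  apply: le_trans (ler_normB _ _) _; rewrite !normr_spow// mulr_natl mulr2n.
  by rewrite lerD ?ge0_ler_powR ?nnegrE ?le_max ?lexx ?normr_ge0 ?orbT ?(ltW q0).
rewrite powRM ?powR_ge0// ler_wpM2l ?powR_ge0// -powRrM.
by rewrite /Num.max; case: ifP => _; rewrite ?lerDl ?lerDr powR_ge0.
Qed.

End Powers.

(** * Sums over a weighted graph *)

Section Graph.
Context {R : realType} {V : countType} (G : wgraph R V).
Implicit Types (x y z : V) (s : seq V) (f g : V -> R) (p : R).

Lemma mu_sum x s : uniq s -> (forall y, 0 < G x y -> y \in s) ->
  mu G x = \sum_(y <- s) G x y.
Proof.
move=> us xs; rewrite /mu /vertex_weight [RHS]fsbig_seq//.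
rewrite (@fsbig_widen _ _ _ _ (neighbors G x) [set` s] (G x))//= => y [_ /= /negP].
by rewrite -leNgt => yx; apply/eqP; rewrite eq_le yx weight_ge0.
Qed.

Lemma neighbors_seq x : exists2 s, uniq s & forall y, 0 < G x y -> y \in s.
Proof.
exists (fset_set (neighbors G x)); first exact: fset_uniq.
by move=> y xy; rewrite in_fset_set ?inE//; exact: graph_locally_finite.
Qed.

Lemma mu_ge0 x : 0 <= mu G x.
Proof.
by have [s us /(mu_sum us)->] := neighbors_seq x; apply: sumr_ge0 => *; exact: weight_ge0.
Qed.

Lemma mu_lower_bound : exists2 mu0, 0 < mu0 & forall x, mu0 <= mu G x.
Proof.
exists (inf (range (vertex_weight G))); first exact: vertex_weight_inf.
by move=> x; apply: ge_inf; [exists 0 => _ [y _ <-]; exact: mu_ge0|exists x].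
Qed.

Lemma mu_gt0 x : 0 < mu G x.
Proof. by have [m m0 /(_ x)] := mu_lower_bound; exact: lt_le_trans. Qed.

Lemma sum_weight_le x s : uniq s -> \sum_(y <- s) G x y <= mu G x.
Proof.
move=> us; have [s' us' xs'] := neighbors_seq x.
rewrite (mu_sum us' xs') (bigID (mem s'))/= [X in _ + X]big1 ?addr0; last first.
  move=> y; apply: contraNeq => Gxy; apply: xs'.
  by rewrite lt_neqAle eq_sym Gxy weight_ge0.
rewrite -big_filter (perm_big [seq y <- s' | y \in s])/=; last first.
  by apply: uniq_perm; rewrite ?filter_uniq// => y; rewrite !mem_filter andbC.
rewrite big_filter big_mkcond/=; apply: ler_sum => y _.
by case: ifP => // _; exact: weight_ge0.
Qed.

(** Multiplying by [mu x] removes the normalisation of the Laplacian and allows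
any finite set of vertices containing the neighbors of [x]. *)
Lemma mu_plaplacian p f x s : uniq s -> (forall y, 0 < G x y -> y \in s) ->
  mu G x * plaplacian G p f x =
  \sum_(y <- s) `|f y - f x| `^ (p - 2) * (f y - f x) * G x y.
Proof.
move=> us xs; rewrite /plaplacian mulVKf ?gt_eqF ?mu_gt0// [RHS]fsbig_seq//.
rewrite (fsbig_widen [set` s] [set: V])//= => y [_ /= ys].
suff -> : G x y = 0 by rewrite mulr0.
by apply/eqP; apply: contra_notT ys => Gxy; apply: xs; rewrite lt_neqAle eq_sym Gxy weight_ge0.
Qed.

Definition interior_vertex s x := x \in s /\ forall y, 0 < G x y -> y \in s.

(** Interior vertices of [s] have all their neighbors in [s], so that functions
supported there may be summed by parts over [s] without boundary terms. *)
Definition supported f s := forall x, f x != 0 -> interior_vertex s x.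

Lemma sum_sym (h : V -> V -> R) s :
  \sum_(x <- s) \sum_(y <- s) h x y * G x y =
  \sum_(x <- s) \sum_(y <- s) h y x * G x y.
Proof.
rewrite exchange_big/=; apply: eq_bigr => x _; apply: eq_bigr => y _.
by rewrite weight_sym.
Qed.

(** Summation by parts: the flux is antisymmetric in its endpoints, so exchanging
them and averaging replaces [g x] by the increment of [g]. *)
Lemma green p f g s : uniq s -> supported g s ->
  \sum_(x <- s) g x * (mu G x * plaplacian G p f x) =
  - 2^-1 * \sum_(x <- s) \sum_(y <- s)
    `|f y - f x| `^ (p - 2) * (f y - f x) * (g y - g x) * G x y.
Proof.
move=> us gs; pose F x y := `|f y - f x| `^ (p - 2) * (f y - f x).
pose S := \sum_(x <- s) \sum_(y <- s) (g x * F x y) * G x y.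
have -> : \sum_(x <- s) g x * (mu G x * plaplacian G p f x) = S.
  apply: eq_bigr => x _; have [->|gx] := eqVneq (g x) 0.
    by rewrite mul0r big1// => y _; rewrite !mul0r.
  rewrite (mu_plaplacian _ _ us (gs _ gx).2) mulr_sumr.
  by apply: eq_bigr => y _; rewrite mulrA.
have S2 : S = - \sum_(x <- s) \sum_(y <- s) (g y * F x y) * G x y.
  rewrite /S sum_sym -sumrN; apply: eq_bigr => x _.
  rewrite -sumrN; apply: eq_bigr => y _.
  by rewrite /F distrC -(opprB (f y)) !mulrN mulNr.
have -> : \sum_(x <- s) \sum_(y <- s)
    `|f y - f x| `^ (p - 2) * (f y - f x) * (g y - g x) * G x y = - S - S.
  rewrite {1}S2 opprK /S -sumrB; apply: eq_bigr => x _.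
  by rewrite -sumrB; apply: eq_bigr => y _; rewrite /F; ring.
by field.
Qed.

(** The weights of the edges at [x] add up to at most [mu x], and each vertex
occurs in both positions. *)
Lemma sum_pair_le (h : V -> R) s : uniq s -> (forall x, 0 <= h x) ->
  \sum_(x <- s) \sum_(y <- s) (h x + h y) * G x y <=
  2 * \sum_(x <- s) h x * mu G x.
Proof.
move=> us h0.
have L : \sum_(x <- s) \sum_(y <- s) h x * G x y <= \sum_(x <- s) h x * mu G x.
  by apply: ler_sum => x _; rewrite -mulr_sumr ler_wpM2l ?sum_weight_le.
have -> : \sum_(x <- s) \sum_(y <- s) (h x + h y) * G x y =
  \sum_(x <- s) \sum_(y <- s) h x * G x y + \sum_(x <- s) \sum_(y <- s) h x * G x y.
  rewrite [in X in _ + X](sum_sym (fun x y => h x)) -big_split/=.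
  by apply: eq_bigr => x _; rewrite -big_split/=; apply: eq_bigr => y _; rewrite mulrDl.
by rewrite mulr_natl mulr2n lerD.
Qed.

Lemma esum_seq (T : choiceType) (s : seq T) (a : T -> R) : uniq s ->
  (forall t, 0 <= a t) -> (forall t, t \notin s -> a t = 0) ->
  (\esum_(t in [set: T]) (a t)%:E = (\sum_(t <- s) a t)%:E)%E.
Proof.
move=> us a0 as0.
rewrite -sumEFin fsbig_seq// -esum_fset//; last by move=> t _; rewrite lee_fin.
rewrite [RHS]esum_mkcond; apply: eq_esum => t _; case: ifPn => //.
by rewrite notin_setE/= => /negP/as0->.
Qed.

(** The Faber-Krahn inequality with its extended sums evaluated on a finite set.
As [Lam] is decreasing, the measure of the support may be replaced by any
upper bound [v]. *)
Lemma faber_krahn_seq p Lam f s v : FK_function p Lam -> faber_krahn G p Lam ->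
  0 < p -> uniq s -> supported f s -> 0 < v ->
  \sum_(x <- s | f x != 0) mu G x <= v ->
  Lam v * \sum_(x <- s) `|f x| `^ p * mu G x <=
  \sum_(x <- s) \sum_(y <- s) `|f y - f x| `^ p * G x y.
Proof.
move=> [Lam0 _ Lamdec _] FK p0 us fs v0 fv.
have [f0|/existsNP[x1 fx1]] := pselect (forall x, f x = 0).
  rewrite big1 ?mulr0; last by move=> x _; rewrite f0 normr0 powR0 ?mul0r ?gt_eqF.
  by apply: sumr_ge0 => x _; apply: sumr_ge0 => y _; rewrite mulr_ge0 ?powR_ge0 ?weight_ge0.
pose U := [set` [seq x <- s | f x != 0]].
have x1U : x1 \in [seq x <- s | f x != 0].
  by move/eqP: fx1 => fx1; rewrite mem_filter fx1 (fs _ fx1).1.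
have muU : muV G U = \sum_(x <- s | f x != 0) mu G x.
  by rewrite /muV -fsbig_seq ?filter_uniq// big_filter.
have muU0 : 0 < muV G U.
  rewrite muU -big_filter (big_rem _ x1U)/= ltr_pwDl ?mu_gt0//.
  by apply: sumr_ge0 => x _; exact: mu_ge0.
have := FK U f (finite_seq _).
have fU x : ~ U x -> f x = 0.
  by rewrite /U/= mem_filter; apply: contra_notP => /eqP fx; rewrite fx (fs _ fx).1.
move=> /(_ fU).
rewrite (esum_seq us); first last.
- move=> x xs; suff -> : f x = 0 by rewrite normr0 powR0 ?mul0r ?gt_eqF.
  by apply/eqP; apply: contraNT xs => /fs[].
- by move=> x; rewrite mulr_ge0 ?powR_ge0 ?mu_ge0.
rewrite (@esum_seq _ [seq (x, y) | x <- s, y <- s]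
  (fun e => `|f e.2 - f e.1| `^ p * G e.1 e.2)); first last.
- move=> [x y]/= xys.
  have [Gxy|] := ltP 0 (G x y); last first.
    by move=> Gxy; rewrite [X in _ * X](_ : _ = 0) ?mulr0//; apply/eqP; rewrite eq_le Gxy weight_ge0.
  have [fx fy] : f x = 0 /\ f y = 0.
    split; apply/eqP; apply: contraNT xys => /fs[H1 H2]; apply/allpairsP.
      by exists (x, y); split => //; exact: H2.
    by exists (x, y); split => //; apply: H2; rewrite weight_sym.
  by rewrite fx fy subrr normr0 powR0 ?mul0r ?gt_eqF.
- by move=> [x y]/=; rewrite mulr_ge0 ?powR_ge0 ?weight_ge0.
- by apply: allpairs_uniq => //= -[? ?] [? ?] _ _ /=.
rewrite big_allpairs/= -EFinM lee_fin; apply: le_trans.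
apply: ler_wpM2r.
  by apply: sumr_ge0 => x _; rewrite mulr_ge0 ?powR_ge0 ?mu_ge0.
move: fv; rewrite -muU le_eqVlt => /predU1P[->//|/Lamdec].
by rewrite !in_itv/= !andbT => /(_ v0 muU0)/ltW.
Qed.

Variable x0 : V.
Local Notation d x := (gdist G x x0).

Lemma gdist_le x n : has_walk G x x0 n -> (d x <= n)%N.
Proof. by move=> H; rewrite /gdist; case: ex_minnP => m _; apply; apply/asboolP. Qed.

Lemma gdist_walk x : has_walk G x x0 (d x).
Proof. by rewrite /gdist; case: ex_minnP => m /asboolP. Qed.

Lemma gdist_neighbor x y : 0 < G x y -> (d x <= (d y).+1)%N.
Proof.
move=> xy; have [s [ps ls ss]] := gdist_walk y.
by apply: gdist_le; exists (y :: s); rewrite /= xy ps ls ss.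
Qed.

Lemma gdist_pred x n : d x = n.+1 -> exists2 y, 0 < G y x & (d y <= n)%N.
Proof.
move=> dx; have := gdist_walk x; rewrite dx => -[[|y s] [//= /andP[xy ps] ls [ss]]].
by exists y; [rewrite weight_sym|apply: gdist_le; exists s].
Qed.

(** By local finiteness, as a vertex at distance [n.+1] is a neighbor of a vertex
at distance at most [n]. *)
Lemma gball_finite n : finite_set [set x | (d x <= n)%N].
Proof.
elim: n => [|n IH].
  apply: (@sub_finite_set _ _ [set x0]); last exact: finite_set1.
  move=> x /=; rewrite leqn0 => /eqP dx; have := gdist_walk x; rewrite dx.
  by move=> [s [_ <- /eqP/nilP->]].
apply: (@sub_finite_set _ _ ([set x | (d x <= n)%N] `|`
    \bigcup_(y in [set x | (d x <= n)%N]) neighbors G y)).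
  move=> x /=; rewrite leq_eqVlt => /predU1P[/gdist_pred[y yx dy]|]; last by left.
  by right; exists y.
rewrite finite_setU; split => //; apply: bigcup_finite => // y _.
exact: graph_locally_finite.
Qed.

Definition ball_seq n : seq V := fset_set [set x | (d x <= n)%N].

Lemma mem_ball_seq n x : (x \in ball_seq n) = (d x <= n)%N.
Proof. by rewrite /ball_seq in_fset_set ?mem_setE//; exact: gball_finite. Qed.

Lemma ball_seq_uniq n : uniq (ball_seq n).
Proof. exact: fset_uniq. Qed.

Lemma ball_seq_interior n x : (d x < n)%N -> interior_vertex (ball_seq n) x.
Proof.
move=> dx; split=> [|y xy]; rewrite mem_ball_seq; first exact: ltnW.
by rewrite weight_sym in xy; exact: leq_trans (gdist_neighbor xy) dx.
Qed.

Definition tent (r : R) x : R := Num.max 0 (1 - (d x)%:R / r).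

Lemma tent_ge0 r x : 0 <= tent r x.
Proof. by rewrite /tent le_max lexx. Qed.

Lemma tent_le1 r x : 0 < r -> tent r x <= 1.
Proof. by move=> r0; rewrite /tent ge_max ler01 gerBl divr_ge0// ltW. Qed.

Lemma tent_lipschitz r x y : 0 < r -> 0 < G x y -> `|tent r y - tent r x| <= r^-1.
Proof.
move=> r0 xy.
suff H x' y' : 0 < G x' y' -> tent r y' - tent r x' <= r^-1.
  by rewrite ler_norml (H _ _ xy) andbT -lerN2 opprK opprB H// weight_sym.
move=> /gdist_neighbor; rewrite -(ler_nat R) -(@ler_pM2r _ r^-1) ?invr_gt0// => h.
have ri : 0 < r^-1 by rewrite invr_gt0.
rewrite lerBlDr {1}/tent ge_max addr_ge0 ?tent_ge0 ?(ltW ri)//=.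
have : 1 - (d x')%:R / r <= tent r x' by rewrite /tent le_max lexx orbT.
move: h; rewrite -natr1 mulrDl mul1r; lra.
Qed.

Lemma tent_eq0 r x : 0 < r -> r <= (d x)%:R -> tent r x = 0.
Proof.
move=> r0 rd; apply/max_idPl; rewrite subr_le0 ler_pdivlMr// mul1r//.
Qed.

Lemma tent_supported n f : (0 < n)%N -> (forall x, f x != 0 -> tent n%:R x != 0) ->
  supported f (ball_seq n).
Proof.
move=> n0 H x /H fx; apply: ball_seq_interior.
rewrite ltnNge; apply: contra fx => nd; apply/eqP/tent_eq0; first by rewrite ltr0n.
by rewrite ler_nat.
Qed.

End Graph.

(** * Calculus in the time variable *)

Section Calculus.
Context {R : realType}.

(** Continuity from the right is needed at the initial time, where the equation
does not hold; it follows from the convergence of the difference quotients. *)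
Lemma C1_on_cvg_right (I : set R) (f : R -> R) (t : R) : C1_on I f -> I t ->
  (\forall s \near t^'+, I s) -> f s @[s --> t^'+] --> f t.
Proof.
move=> [g _ df] It rI.
have dft : (f s - f t) / (s - t) @[s --> t^'+] --> g t.
  apply: cvg_trans (df _ It); apply: cvg_app => A.
  move=> nA.
  have nA' : \forall s \near t, s != t -> I s -> A s by exact: nA.
  have rI' : \forall s \near t, t < s -> I s by exact: rI.
  have : \forall s \near t, t < s -> A s.
    by apply: filterS2 nA' rI' => s h1 h2 ts; apply: h1; [rewrite gt_eqF|exact: h2].
  exact.
have idt : (s - t : R) @[s --> t^'+] --> 0.
  rewrite -(subrr t); apply: cvgB; last exact: cvg_cst.
  by apply: cvg_within_filter; exact: cvg_id.
have H : f t + (f s - f t) / (s - t) * (s - t) @[s --> t^'+] --> f t + g t * 0.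
  by apply: cvgD; [exact: cvg_cst|exact: cvgM].
rewrite mulr0 addr0 in H; apply: cvg_trans H; apply: near_eq_cvg; near=> s => /=.
have ts : t < s by near: s; exact: nbhs_right_gt.
by rewrite /= divfK ?subr_eq0 ?gt_eqF// addrC subrK.
Unshelve. all: by end_near. Qed.

(** The exponent exceeds 1, which makes the derivative exist, and vanish, at 0
too. *)
Lemma is_derive_norm_powR (s v : R) : 1 < s ->
  is_derive v 1 (fun x : R => `|x| `^ s) (s * spow v (s - 1)).
Proof.
move=> s1.
have [v0|v0|<-] := ltgtP 0 v.
- rewrite spow_ge0E ?subr_gt0//; last exact: ltW.
  apply: (@near_eq_is_derive _ _ _ (fun x => x `^ s)); last exact: is_derive1_powR.
  near=> x; rewrite gtr0_norm//; near: x; exact: lt_nbhsr.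
- have -> : s * spow v (s - 1) = (s * (- v) `^ (s - 1)) * (- 1).
    rewrite -{1}[v]opprK spowN spow_ge0E ?subr_gt0 ?oppr_ge0 ?ltW//; ring.
  apply: (@near_eq_is_derive _ _ _ ((fun x => x `^ s) \o -%R)).
    near=> x => /=; rewrite ltr0_norm//; near: x; exact: lt_nbhsl.
  apply: is_derive1_comp; apply: is_derive1_powR; lra.
- have -> : s * spow (0 : R) (s - 1) = 0.
    by rewrite spow_ge0E ?subr_gt0// powR0 ?mulr0// gt_eqF// subr_gt0.
  have H : (fun h : R => h^-1 *: (((fun x : R => `|x| `^ s) \o shift (0 : R))
      (h *: (1 : R)) - `|0 : R| `^ s))
      @ 0^' --> (0 : R).
    apply/cvgrPdist_lt => e e0.
    have e1 : 0 < e `^ (s - 1)^-1 by exact: powR_gt0.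
    near=> h.
    have h0 : h != 0 by near: h; exact: nbhs_dnbhs_neq.
    have he : `|h| < e `^ (s - 1)^-1.
      by near: h; apply: dnbhs0_lt.
    rewrite /= sub0r normrN addr0 normr0 powR0 ?subr0; last by rewrite gt_eqF//; lra.
    rewrite [h *: 1]mulr1 [_ *: _]mulrC normrM normfV ger0_norm ?powR_ge0//.
    rewrite -mulr_powRB1 ?normr_ge0//; last by lra.
    rewrite mulrAC divff ?normr_eq0// mul1r.
    have -> : e = (e `^ (s - 1)^-1) `^ (s - 1).
      by rewrite -powRrM mulVf ?powRr1 ?ltW//; lra.
    by rewrite gt0_ltr_powR ?nnegrE ?normr_ge0 ?powR_ge0// subr_gt0.
  split; first by apply/cvg_ex; exists 0.
  exact: cvg_lim H.
Unshelve. all: by end_near. Qed.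

(** The right endpoint is included in the hypothesis on the derivative, so that
continuity remains to be assumed only at the left endpoint. *)
Lemma derive_ge0_le (f : R -> R) (a b : R) : a <= b ->
  (forall x, a < x -> x <= b -> exists2 l, is_derive x 1 f l & 0 <= l) ->
  f x @[x --> a^'+] --> f a -> f a <= f b.
Proof.
rewrite le_eqVlt => /predU1P[->//|ab] df fa.
have cf x : a < x -> x <= b -> {for x, continuous f}.
  move=> ax xb; have [l [dfx _] _] := df _ ax xb.
  exact/differentiable_continuous/derivable1_diffP.
have [||c /[!in_itv]/= /andP[ac cb] E] := @MVT _ f (derive1 f) _ _ ab.
- move=> x; rewrite in_itv/= => /andP[ax xb].
  have [l dl _] := df _ ax (ltW xb).
  by rewrite derive1E; apply: derivableP; exact: ex_derive.
- apply/continuous_within_itvP => //; split => //.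
    by move=> x; rewrite in_itv/= => /andP[ax xb]; apply: cf => //; exact: ltW.
  by apply: cvg_at_left_filter; exact: cf.
have [l dl l0] := df _ ac (ltW cb).
by rewrite -subr_ge0 E derive1E (derive_val (is_derive:=dl)) mulr_ge0// subr_ge0 ltW.
Qed.

Lemma is_derive_sum_seq (T : Type) (s : seq T) (f : T -> R -> R) (df : T -> R) (x : R) :
  (forall i, is_derive x 1 (f i) (df i)) ->
  is_derive x 1 (fun t => \sum_(i <- s) f i t) (\sum_(i <- s) df i).
Proof.
move=> H; elim: s => [|i s IH].
  rewrite big_nil (_ : (fun _ => _) = cst 0); last by apply/funext => t; rewrite big_nil.
  exact: is_derive_cst.
rewrite big_cons (_ : (fun _ => _) = f i + (fun t => \sum_(i <- s) f i t)).
  exact: is_deriveD.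
by apply/funext => t; rewrite big_cons.
Qed.

Lemma cvg_sum_seq (T : Type) (s : seq T) (U : Type) (F : set_system U) {FF : Filter F}
  (f : T -> U -> R) (l : T -> R) :
  (forall i, f i t @[t --> F] --> l i) ->
  \sum_(i <- s) f i t @[t --> F] --> \sum_(i <- s) l i.
Proof.
move=> H; elim: s => [|i s IH].
  rewrite big_nil (_ : (fun _ => _) = cst 0); last by apply/funext => t; rewrite big_nil.
  exact: cvg_cst.
rewrite big_cons (_ : (fun _ => _) = f i \+ (fun t => \sum_(i <- s) f i t)).
  exact: cvgD.
by apply/funext => t; rewrite big_cons.
Qed.

(** Otherwise the interval, which has positive length, would be negligible. *)
Lemma ae_exists_itv (P : R -> Prop) (a b : R) : a < b ->
  {ae @lebesgue_measure R, forall t, P t} ->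
  exists t, [/\ a < t, t < b & P t].
Proof.
move=> ab [N [mN N0 PN]]; apply: contrapT => H.
have sub : `]a, b[%classic `<=` N.
  move=> t /=; rewrite in_itv/= => /andP[at_ tb]; apply: PN => /= Pt.
  by apply: H; exists t.
have := le_measure (@lebesgue_measure R) _ _ sub.
rewrite !inE => /(_ (measurable_itv _) mN).
have itvE := @lebesgue_measure_itv R `]a, b[; rewrite /= lte_fin ab -EFinB in itvE.
move=> /le_trans => /(_ 0%E); rewrite [X in (X <= _)%E -> _]N0 => /(_ (lexx _)).
by rewrite [X in (X <= _)%E -> _]itvE lee_fin subr_le0 leNgt ab.
Qed.

End Calculus.

Section Solution.
Context {R : realType} {V : countType} (G : wgraph R V).

Lemma lnorm1E (U : set V) (f : V -> R) :
  lnorm G 1 U f = (\esum_(x in U) (`|f x| * mu G x)%:E)%E.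
Proof.
rewrite /lnorm invr1 poweRe1.
  by apply: eq_esum => x _; rewrite powRr1.
by apply: esum_ge0 => x _; rewrite lee_fin mulr_ge0 ?powR_ge0 ?mu_ge0.
Qed.

Lemma sum_le_lnorm1 (U : set V) (f : V -> R) (s : seq V) : uniq s ->
  (forall x, x \in s -> U x) ->
  ((\sum_(x <- s) `|f x| * mu G x)%:E <= lnorm G 1 U f)%E.
Proof.
move=> us sU; rewrite lnorm1E; apply: esum_ge; exists [set` s].
  by split; [exact: finite_seq|move=> x /= /sU].
by rewrite -sumEFin fsbig_seq.
Qed.

Lemma solution_right_cont p q T u0 u x t : is_solution G p q T u0 u ->
  0 <= t -> (t%:E < T)%E -> u x s @[s --> t^'+] --> u x t.
Proof.
move=> [_ C1 _ _] t0 tT; apply: (C1_on_cvg_right (C1 x)) => //.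
have [t' tt' t'T] : exists2 t', t < t' & (t'%:E <= T)%E.
  case: T tT {C1} => [T| |//]; last by exists (t + 1); [lra|rewrite leey].
  by rewrite lte_fin => tT; exists T.
near=> s; split.
  by apply: (le_trans t0); near: s; exact: nbhs_right_ge.
apply: lt_le_trans t'T; rewrite lte_fin.
by near: s; exact: nbhs_right_lt.
Unshelve. all: by end_near. Qed.

(** The norm is only assumed to be bounded for almost every time.  A finite partial
sum exceeding the bound would do so on a right neighborhood by continuity, and
this neighborhood contains a time at which the bound holds. *)
Lemma solution_l1_bound p q T u0 u : is_solution G p q T u0 u ->
  exists2 M, 0 < M & forall t s, 0 <= t -> (t%:E < T)%E -> uniq s ->
    \sum_(x <- s) `|u x t| * mu G x <= M.
Proof.
move=> Hu; have [[_ [M HM]] _ _ _] := Hu.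
exists (Num.max M 1); first by rewrite lt_max ltr01 orbT.
move=> t s t0 tT us; rewrite le_max; apply/orP; left; rewrite leNgt; apply/negP => Ms.
have C : \sum_(x <- s) `|u x t'| * mu G x @[t' --> t^'+] --> \sum_(x <- s) `|u x t| * mu G x.
  apply: cvg_sum_seq => x; apply: cvgM; last exact: cvg_cst.
  by apply: cvg_norm; apply: solution_right_cont Hu _ _.
have : \forall t' \near t^'+, M < \sum_(x <- s) `|u x t'| * mu G x.
  exact: (cvgr_gt _ C _ Ms).
have [tm ttm tmT] : exists2 t', t < t' & (t'%:E <= T)%E.
  case: T tT {HM C Hu} => [T| |//]; last by exists (t + 1); [lra|rewrite leey].
  by rewrite lte_fin => tT; exists T.
rewrite near_withinE => -[e/= e0 He].
have [|t' [tt' t'e Mt']] := @ae_exists_itv _ _ t (Num.min tm (t + e)) _ HM.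
  by rewrite lt_min ttm/= ltrDl.
have := t'e; rewrite lt_min => /andP[t'tm t'e'].
have It' : time_interval T t'.
  by split; [lra|apply: lt_le_trans tmT; rewrite lte_fin].
have := le_trans (sum_le_lnorm1 (u^~ t') us (fun x _ => I)) (Mt' It').
rewrite lee_fin leNgt => /negP; apply; apply: He => //=.
by rewrite ltr0_norm; lra.
Qed.

End Solution.

(** * The function psi1 and its inverse *)

Section Scaling.
Context {R : realType} (p q : R) (Lam : R -> R).
Hypotheses (p1 : 1 < p) (hpq : 1 < q * (p - 1)) (hLam : FK_function p Lam).
Local Notation a := (q * (p - 1) - 1).
Local Notation psi := (psi1 p q Lam).
Local Notation phi := (phi1 p q Lam).
Implicit Types s z la : R.

Lemma Lam_gt0 s : 0 < s -> 0 < Lam s.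
Proof. by move=> s0; have [H _ _ _] := hLam; apply: H; rewrite in_itv/= s0. Qed.

Lemma Lam_le s z : 0 < s -> s <= z -> Lam z <= Lam s.
Proof.
move=> s0; rewrite le_eqVlt => /predU1P[->//|sz].
have [_ _ H _] := hLam; apply/ltW/H => //; rewrite in_itv/= ?s0//.
by rewrite (lt_trans s0 sz).
Qed.

Lemma psi1_gt0 s : 0 < s -> 0 < psi s.
Proof. by move=> s0; rewrite mulr_gt0 ?powR_gt0 ?Lam_gt0 ?invr_gt0. Qed.

(** [Lam] decreases at least as fast as the power [- (p / N)]; hence [psi1] grows at
least like a power whose exponent is strictly larger than the exponent [a] that
the monotonicity of [Lam] alone would give. *)
Lemma psi1_scaling : exists2 b : R, a < b & forall la s, 1 <= la -> 0 < s ->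
  la `^ b * psi s <= psi (la * s).
Proof.
have [_ _ _ [N [nu [N0 mono _]]]] := hLam.
exists (a + p / N); first by rewrite ltrDl divr_gt0// (lt_trans ltr01 p1).
move=> la s la1 s0; have la0 : 0 < la by lra.
have ls0 : 0 < la * s by rewrite mulr_gt0.
have key : la `^ (p / N) * Lam s^-1 <= Lam (la * s)^-1.
  have := mono (la * s)^-1 s^-1; rewrite !in_itv/= !andbT !invr_gt0 ls0 s0.
  rewrite lef_pV2 ?posrE// ler_peMl ?(ltW s0)// => /(_ isT isT isT).
  rewrite !powRN -[X in _ * X <= _ -> _]powRN -[X in _ <= _ * X -> _]powRN.
  have inv z : 0 < z -> z^-1 `^ (- (p / N)) = z `^ (p / N).
    by move=> z0; rewrite -powR_inv1 ?(ltW z0)// -powRrM mulN1r opprK.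
  rewrite !inv// powRM ?(ltW la0) ?(ltW s0)//.
  have P : 0 < Lam (la * s)^-1 by rewrite Lam_gt0 ?invr_gt0.
  have Q : 0 < Lam s^-1 by rewrite Lam_gt0 ?invr_gt0.
  rewrite mulrA ler_pM2r ?powR_gt0// ler_pdivrMl// mulrC.
  by rewrite -ler_pdivlMr ?invr_gt0// invrK => ->.
rewrite /psi1 powRM ?(ltW la0) ?(ltW s0)//.
rewrite powRD; last by rewrite (gt_eqF la0) implybT.
rewrite [leLHS](_ : _ = la `^ a * s `^ a * (la `^ (p / N) * Lam s^-1)); last by ring.
by rewrite ler_pM2l ?mulr_gt0 ?powR_gt0.
Qed.

Lemma psi1_lt s z : 0 < s -> s < z -> psi s < psi z.
Proof.
move=> s0 sz; have [b ab H] := psi1_scaling.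
have z1 : 1 < z / s by rewrite ltr_pdivlMr// mul1r.
have := H (z / s) s (ltW z1) s0; rewrite divfK ?gt_eqF//; apply: lt_le_trans.
rewrite ltr_pMl ?psi1_gt0//.
have p1b : 1 `^ b = 1 by rewrite powR1.
have b0 : 0 < b by have := hpq; lra.
by rewrite -[ltLHS]p1b gt0_ltr_powR ?nnegrE// (le_trans ler01 (ltW z1)).
Qed.

Lemma psi1_continuous s : 0 < s -> {for s, continuous psi}.
Proof.
move=> s0; have [_ cL _ _] := hLam.
have c1 : {for s, continuous (fun x : R => x `^ a)}.
  apply/differentiable_continuous/derivable1_diffP.
  by apply: derivable_powR; rewrite in_itv/= s0.
suff c2 : {for s, continuous (Lam \o (fun x : R => x^-1))} by exact: cvgM c1 c2.
apply: continuous_comp.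
  by apply: inv_continuous; rewrite gt_eqF.
by apply: cL; rewrite in_itv/= andbT invr_gt0.
Qed.

(** By the scaling inequality [psi1] takes values above and below [z], and the
intermediate value theorem applies. *)
Lemma psi1_surj z : 0 < z -> exists2 s, 0 < s & psi s = z.
Proof.
move=> z0; have [b ab H] := psi1_scaling.
have b0 : 0 < b by have := hpq; lra.
pose w := psi 1; have w0 : 0 < w by exact: psi1_gt0.
(* [la `^ b] dominates both [z / w] and [w / z] *)
pose la := 1 + (z / w) `^ b^-1 + (w / z) `^ b^-1.
have la1 : 1 <= la by rewrite /la -addrA lerDl addr_ge0 ?powR_ge0.
have la0 : 0 < la by lra.
have le_la y : 0 < y -> y `^ b^-1 <= la -> y <= la `^ b.
  move=> y0 yl; rewrite -[leLHS](@powRr1 _ y) ?(ltW y0)// -(@mulVf _ b) ?gt_eqF//.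
  by rewrite powRrM ge0_ler_powR ?nnegrE ?powR_ge0//; lra.
have zla : z / w <= la `^ b.
  by apply: le_la; rewrite ?divr_gt0// /la; have := powR_ge0 (w / z) b^-1; lra.
have wla : w / z <= la `^ b.
  by apply: le_la; rewrite ?divr_gt0// /la; have := powR_ge0 (z / w) b^-1; lra.
have hi : z <= psi la.
  have := H la 1 la1 ltr01; rewrite mulr1; apply: le_trans.
  by rewrite -ler_pdivrMr.
have lo : psi la^-1 <= z.
  have := H la la^-1 la1; rewrite invr_gt0 mulfV ?gt_eqF// => /(_ la0) => h.
  rewrite -(@ler_pM2l _ (la `^ b)) ?powR_gt0//; apply: (le_trans h).
  by rewrite -ler_pdivrMr.
have lola : la^-1 <= la by rewrite (@le_trans _ _ 1)// invf_le1.
have ila0 : 0 < la^-1 by rewrite invr_gt0.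
have [||c] := @IVT _ psi la^-1 la z lola.
- apply: continuous_in_subspaceT => x; rewrite inE/= in_itv/= => /andP[x1 x2].
  by apply: psi1_continuous; lra.
- by rewrite ge_min lo/= le_max hi orbT.
by rewrite in_itv/= => /andP[c1 c2] <-; exists c => //; lra.
Qed.

Lemma phi1P z : 0 < z -> 0 < phi z /\ psi (phi z) = z.
Proof.
move=> z0.
have surj : set_surj (`]0, +oo[%classic : set R) (`]0, +oo[%classic : set R) psi.
  move=> y /=; rewrite in_itv/= andbT => /psi1_surj[s s0 <-].
  by exists s => //=; rewrite in_itv/= s0.
have zI : z \in (`]0, +oo[%classic : set R) by rewrite inE/= in_itv/= z0.
split; last exact: (surjpK _ surj zI).
have : (`]0, +oo[%classic : set R) (phi z).
  by apply: (surjpinv_image_sub surj); exists z => //; rewrite inE in zI.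
by rewrite /= in_itv/= andbT.
Qed.

(** A constant factor in the argument of [phi1] costs only a constant factor in its
value; this absorbs all constants of the decay estimate. *)
Lemma le_phi1 (b : R) la s z : (forall la s, 1 <= la -> 0 < s -> la `^ b * psi s <= psi (la * s)) ->
  1 <= la -> 0 < s -> 0 < z -> psi s <= la `^ b * z -> s <= la * phi z.
Proof.
move=> H la1 s0 z0; apply: contraTT; rewrite -!ltNge => ls.
have [phi0 phiE] := phi1P z0.
apply: le_lt_trans (psi1_lt _ ls); last by rewrite mulr_gt0//; lra.
by rewrite -[in leLHS]phiE; exact: H.
Qed.

(** Going back in time from [t] to [s], the decay scale [phi1 (t^-1 * m)] grows
at most by a power of [t / s] with an exponent strictly smaller than [a^-1]. *)
Lemma phi1_decay : exists2 b : R, a < b & forall m s t, 0 < m -> 0 < s -> s <= t ->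
  phi (s^-1 * m) <= (t / s) `^ b^-1 * phi (t^-1 * m).
Proof.
have [b ab H] := psi1_scaling; exists b => // m s t m0 s0 st.
have t0 : 0 < t by lra.
have [phi0 phiE] := @phi1P (s^-1 * m) (mulr_gt0 (eqbRL (invr_gt0 s) s0) m0).
apply: (le_phi1 H) => //.
- have p1b : 1 `^ b^-1 = 1 by rewrite powR1.
  rewrite -[leLHS]p1b ge0_ler_powR ?nnegrE ?invr_ge0 ?divr_ge0//; try (have := hpq; lra).
  by rewrite ler_pdivlMr// mul1r.
- by rewrite mulr_gt0 ?invr_gt0.
rewrite phiE -powRrM mulVf ?gt_eqF//; last by have := hpq; lra.
rewrite powRr1 ?divr_ge0//; try lra.
by rewrite le_eqVlt; apply/orP; left; apply/eqP; field; lra.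
Qed.

End Scaling.

(** * A differential inequality *)

Section Decay.
Context {R : realType}.

Lemma is_derive_continuous (f : R -> R) (x l : R) : is_derive x 1 f l ->
  {for x, continuous f}.
Proof. by move=> [dfx _]; exact/differentiable_continuous/derivable1_diffP. Qed.

Lemma is_derive_cvg_right (f : R -> R) (x l : R) : is_derive x 1 f l ->
  f s @[s --> x^'+] --> f x.
Proof. by move=> /is_derive_continuous; exact: cvg_at_right_filter. Qed.

(** With [k] chosen so that [(2 * k) `^ th * M = Y tau / 2], the inequality reads
[Y' <= e - c' * Y `^ (1 + p) * Lam (M / k)], because [a / th = p].  Put
[z tau = Y tau - e * tau].  As long as it is positive, [z] is nonincreasing, so
the factor [Lam] may be frozen at its value for the final time, and then
[z `^ (- p)] grows at least linearly.  This bounds [psi1] at [k / M] by a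
multiple of [t^-1]. *)
Lemma ode_decay (p q : R) (Lam : R -> R) (M c m : R) :
  1 < p -> 1 < q * (p - 1) -> FK_function p Lam -> 0 < M -> 0 < c -> 0 < m ->
  let a := q * (p - 1) - 1 in let th := a / p in
  exists2 C, 0 < C & forall (Y : R -> R) (e t : R), 0 < t -> 0 <= e ->
    (forall tau, 0 < tau -> tau <= t -> exists2 l : R, is_derive tau 1 Y l &
      l <= e /\ forall k, 0 < k ->
        l <= e - c * (k `^ a * Lam (M / k) * (Y tau - (2 * k) `^ th * M))) ->
    Y t <= C * phi1 p q Lam (t^-1 * m) `^ th + e * t.
Proof.
move=> p1 hpq hLam M0 c0 m0 a th.
have a0 : 0 < a by rewrite /a; lra.
have p0 : 0 < p by lra.
have th0 : 0 < th by rewrite divr_gt0.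
have M20 : 0 < 2 * M by rewrite mulr_gt0.
have [b ab Hb] := psi1_scaling q p1 hLam.
have b0 : 0 < b by apply: lt_trans ab.
(* solution [k] of [(2 * k) `^ th * M = y / 2] *)
pose kk (y : R) : R := (y / (2 * M)) `^ th^-1 / 2.
have kk_gt0 (y : R) : 0 < y -> 0 < kk y by move=> y0; rewrite divr_gt0// powR_gt0// divr_gt0.
have kk_th (y : R) : 0 < y -> (2 * kk y) `^ th * M = y / 2.
  move=> y0; rewrite /kk [2 * _]mulrC divfK ?gt_eqF//.
  rewrite -powRrM mulVf ?gt_eqF// powRr1 ?divr_ge0 ?(ltW y0) ?(ltW M20)//.
  by field; lra.
have kk_a (y : R) : 0 < y -> kk y `^ a = y `^ p * ((2 * M) `^ p * 2 `^ a)^-1.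
  move=> y0; rewrite /kk powRM ?powR_ge0 ?invr_ge0// -powRrM.
  have -> : th^-1 * a = p by rewrite /th; field; rewrite ?gt_eqF.
  rewrite (@powRM _ y) ?(ltW y0) ?invr_ge0 ?(ltW M20)//.
  have inv (z r : R) : 0 < z -> z^-1 `^ r = (z `^ r)^-1.
    by move=> z0; rewrite -powR_inv1 ?(ltW z0)// -powRrM mulN1r powRN.
  by rewrite !inv// invfM mulrA.
have kk_le (x y : R) : 0 < x -> x <= y -> kk x <= kk y.
  move=> x0 xy; rewrite ler_pM2r ?invr_gt0//.
  rewrite ge0_ler_powR ?nnegrE ?invr_ge0 ?(ltW th0) ?divr_ge0 ?(ltW M20) ?(ltW x0)//.
    by lra.
  by rewrite ler_pM2r ?invr_gt0.
pose D := ((2 * M) `^ p * 2 `^ a)^-1.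
have D0 : 0 < D by rewrite invr_gt0 mulr_gt0 ?powR_gt0.
pose c' := c * D / 2.
have c'0 : 0 < c' by rewrite !mulr_gt0.
pose C6 := D * M `^ (- a) * (2 / (p * c')).
have C60 : 0 < C6.
  by apply: mulr_gt0; [exact: mulr_gt0 D0 (powR_gt0 _ _)|apply: divr_gt0; [|exact: mulr_gt0]].
pose la := 1 + (C6 / m) `^ b^-1.
have la1 : 1 <= la by rewrite lerDl powR_ge0.
have la0 : 0 < la by lra.
have laC : C6 / m <= la `^ b.
  have C6m : 0 <= C6 / m by rewrite divr_ge0// ltW.
  rewrite -[leLHS](@powRr1 _ (C6 / m))// -(@mulVf _ b) ?gt_eqF//.
  rewrite powRrM ge0_ler_powR ?nnegrE ?powR_ge0 ?(ltW la0) ?(ltW b0)//.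
  by rewrite /la; lra.
exists (2 * M * (2 * (M * la)) `^ th); first by rewrite mulr_gt0// powR_gt0// !mulr_gt0.
move=> Y e t t0 e0 HY; rewrite -lerBlDr.
pose z (tau : R) : R := Y tau - e * tau.
have [zt|zt] := leP (z t) 0.
  by apply: (le_trans zt); rewrite !mulr_ge0 ?powR_ge0 ?(ltW M0).
have dz (tau l : R) : is_derive tau 1 Y l -> is_derive tau 1 z (l - e).
  move=> dY; rewrite /z.
  have -> : l - e = l - (e *: (1 : R)) by rewrite [_ *: _]mulr1.
  by apply: is_deriveB.
have zle (tau : R) : 0 < tau -> tau <= t -> z t <= z tau.
  move=> tau0 taut; rewrite -lerN2.
  apply: (@derive_ge0_le _ (fun x => - z x)) => //.
    move=> x taux xt; have [l dY [le _]] := HY x (lt_trans tau0 taux) xt.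
    exists (- (l - e)); last by lra.
    exact: is_deriveN (dz _ _ dY).
  have [l dY _] := HY tau tau0 taut.
  exact: is_derive_cvg_right (is_deriveN (dz _ _ dY)).
pose L := Lam (M / kk (z t)).
have L0 : 0 < L by apply: (Lam_gt0 hLam); rewrite divr_gt0// kk_gt0.
pose K := p * c' * L.
(* the interval stops at [t / 2], as nothing is known about [z] at time 0 *)
have main : z (t / 2) `^ (- p) - K * (t / 2) <= z t `^ (- p) - K * t.
  pose w (tau : R) : R := z tau `^ (- p) - K * tau.
  have dw (tau l : R) : 0 < tau -> tau <= t -> is_derive tau 1 Y l ->
      is_derive tau 1 w ((- p) * z tau `^ (- p - 1) * (l - e) - K).
    move=> tau0 taut dY.
    have ztau : 0 < z tau by apply: lt_le_trans zt (zle _ _ _).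
    have d1 := @is_derive1_comp _ _ _ _ _ _ (is_derive1_powR (- p) ztau) (dz _ _ dY).
    have -> : - p * z tau `^ (- p - 1) * (l - e) - K =
      - p * z tau `^ (- p - 1) * (l - e) - (K *: (1 : R)) by rewrite [_ *: _]mulr1.
    exact: is_deriveB.
  have t2t : t / 2 <= t by lra.
  apply: (@derive_ge0_le _ w) => //.
    move=> x tx xt; have x0 : 0 < x by lra.
    have [l dY [_ Hl]] := HY x x0 xt.
    exists (- p * z x `^ (- p - 1) * (l - e) - K); first exact: dw.
    have zx : 0 < z x by apply: lt_le_trans zt (zle _ _ _).
    have Yx : z x <= Y x by rewrite gerBl mulr_ge0// ltW.
    have Y0 : 0 < Y x by lra.
    have := Hl _ (kk_gt0 _ Y0); rewrite kk_th// kk_a//.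
    have -> : Y x - Y x / 2 = Y x / 2 by field.
    have -> : c * (Y x `^ p / ((2 * M) `^ p * 2 `^ a) * Lam (M / kk (Y x)) * (Y x / 2)) =
        c' * (Y x * Y x `^ p * Lam (M / kk (Y x))).
      by rewrite /c' -/D; field.
    move=> Hl'.
    have LY : z x * z x `^ p * L <= Y x * Y x `^ p * Lam (M / kk (Y x)).
      apply: ler_pM; rewrite ?mulr_ge0 ?powR_ge0 ?(ltW zx) ?(ltW L0)//.
        by rewrite ler_pM ?powR_ge0 ?(ltW zx)// ge0_ler_powR ?nnegrE ?(ltW zx) ?(ltW Y0) ?(ltW p0).
      apply: (Lam_le hLam); first by rewrite divr_gt0// kk_gt0.
      rewrite ler_pM2l// lef_pV2 ?posrE ?kk_gt0// kk_le//.
      exact: le_trans (zle _ _ _) Yx.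
    have : l - e <= - (c' * (z x * z x `^ p * L)).
      by move: (ler_wpM2l (ltW c'0) LY) Hl'; lra.
    have Z0 : 0 < z x `^ (- p - 1) by rewrite powR_gt0.
    move/(ler_wpM2l (ltW (mulr_gt0 p0 Z0))).
    have -> : p * z x `^ (- p - 1) * - (c' * (z x * z x `^ p * L)) =
       - K * (z x `^ (- p - 1) * (z x * z x `^ p)) by rewrite /K; ring.
    have -> : z x `^ (- p - 1) * (z x * z x `^ p) = 1.
      rewrite -{2}[z x]powRr1 ?(ltW zx)// -!powRD ?(gt_eqF zx) ?implybT//.
      by rewrite (_ : _ + _ = 0) ?powRr0//; ring.
    by lra.
  have [|l dY _] := HY (t / 2) _ t2t; first by lra.
  by apply: is_derive_cvg_right (dw _ _ _ t2t dY); lra.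
have ztp : z t `^ p * L * t <= 2 / (p * c').
  have H : K * (t / 2) <= z t `^ (- p).
    by have := powR_ge0 (z (t / 2)) (- p); move: main; lra.
  have zp0 : 0 < z t `^ p by rewrite powR_gt0.
  rewrite ler_pdivlMr ?mulr_gt0//.
  move: H; rewrite powRN -(@ler_pM2l _ (z t `^ p))// mulfV ?gt_eqF// /K; lra.
have s0 : 0 < kk (z t) / M by rewrite divr_gt0// kk_gt0.
have psis : psi1 p q Lam (kk (z t) / M) <= la `^ b * (t^-1 * m).
  rewrite /psi1 invf_div -/L -/a powRM ?invr_ge0 ?(ltW M0) ?(ltW (kk_gt0 _ _))//.
  have -> : M^-1 `^ a = M `^ (- a) by rewrite -powR_inv1 ?(ltW M0)// -powRrM mulN1r.
  rewrite kk_a// -/D; apply: (@le_trans _ _ (C6 / m * (t^-1 * m))); last first.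
    by rewrite ler_pM2r// mulr_gt0// invr_gt0.
  have -> : C6 / m * (t^-1 * m) = D * M `^ (- a) * (2 / (p * c') / t).
    by rewrite /C6; field; rewrite !gt_eqF.
  have -> : z t `^ p * D * M `^ (- a) * L = D * M `^ (- a) * (z t `^ p * L) by ring.
  by rewrite ler_pM2l ?mulr_gt0 ?powR_gt0// ler_pdivlMr.
have := @le_phi1 _ _ _ _ p1 hpq hLam b la _ _ Hb la1 s0 _ psis.
rewrite mulr_gt0 ?invr_gt0// => /(_ isT).
set ph := phi1 _ _ _ _.
have [ph0 _] := @phi1P _ _ _ _ p1 hpq hLam (t^-1 * m) (mulr_gt0 (eqbRL (invr_gt0 t) t0) m0).
rewrite ler_pdivrMr// => kle.
have := kk_th _ zt; set k := kk _ in kle * => E.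
have k0 : 0 < k by exact: kk_gt0.
have -> : Y t - e * t = 2 * ((2 * k) `^ th * M) by rewrite E /z; field.
have -> : 2 * M * (2 * (M * la)) `^ th * ph `^ th = 2 * ((2 * (M * la) * ph) `^ th * M).
  by rewrite [in RHS]powRM ?mulr_ge0 ?(ltW M0) ?(ltW la0) ?(ltW ph0)//; ring.
rewrite ler_pM2l// ler_pM2r//.
have kle' : 2 * k <= 2 * (M * la) * ph.
  by rewrite (_ : 2 * (M * la) * ph = 2 * (la * ph * M)); [rewrite ler_pM2l|ring].
apply: (ge0_ler_powR (ltW th0) _ _ kle'); rewrite nnegrE.
  by rewrite mulr_ge0// ltW.
by rewrite !mulr_ge0 ?(ltW M0) ?(ltW la0) ?(ltW ph0).
Qed.

End Decay.

(** * Estimates at a fixed time *)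

Section Static.
Context {R : realType} {V : countType} (G : wgraph R V) (x0 : V).
Context (p q : R) (Lam : R -> R).
Hypotheses (p1 : 1 < p) (q0 : 0 < q) (hpq : 1 < q * (p - 1)).
Hypotheses (hLam : FK_function p Lam) (hFK : faber_krahn G p Lam).
Implicit Types (v : V -> R) (n : nat) (x y : V).
Local Notation a := (q * (p - 1) - 1).
Local Notation th := (a / p).
Local Notation ga := ((q * (p - 1) + th) / p).

Lemma a_gt0 : 0 < a. Proof. by rewrite subr_gt0. Qed.
Lemma p_gt0 : 0 < p. Proof. exact: lt_trans p1. Qed.
Lemma th_gt0 : 0 < th. Proof. by rewrite divr_gt0 ?a_gt0 ?p_gt0. Qed.
Lemma p_th : p * th = a. Proof. by field; rewrite gt_eqF ?p_gt0. Qed.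
Lemma p_ga : p * ga = q * (p - 1) + th.
Proof. by field; rewrite gt_eqF ?p_gt0. Qed.
Lemma p_gaE : p * ga = 1 + (a + th).
Proof. by rewrite p_ga; ring. Qed.
Lemma th_le_q : th <= q.
Proof.
rewrite -(ler_pM2l p_gt0) p_th; have := q0; have := p1; lra.
Qed.
Lemma th_le_ga : th <= ga.
Proof.
rewrite -(ler_pM2l p_gt0) p_ga.
have := ler_wpM2r (_ : 0 <= p - 1) th_le_q; rewrite subr_ge0 => /(_ (ltW p1)); lra.
Qed.
Lemma ga_le_q : ga <= q.
Proof. rewrite -(ler_pM2l p_gt0) p_ga; have := th_le_q; lra. Qed.
Lemma ga_gt0 : 0 < ga. Proof. exact: lt_le_trans th_gt0 th_le_ga. Qed.
Lemma q_sub_th : (q - th) * (p - 1) = 1 + th.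
Proof. have := p_th; lra. Qed.

Definition l1_le (M : R) v :=
  forall s, uniq s -> \sum_(x <- s) `|v x| * mu G x <= M.

Lemma l1_le_sup (M : R) : 0 < M ->
  exists2 K : R, 0 < K & forall v, l1_le M v -> forall x, `|v x| <= K.
Proof.
move=> M0; have [m m0 mle] := mu_lower_bound G; exists (M / m); first exact: divr_gt0.
move=> v Mv x; rewrite ler_pdivlMr//; apply: le_trans (Mv [:: x] isT).
by rewrite big_seq1 ler_wpM2l.
Qed.

(** Bounded functions turn higher powers into the first power, which is summable
by the l^1 bound. *)
Lemma powR_le_linear (K r k : R) : 0 <= k -> k <= K -> 0 < r -> k `^ (1 + r) <= K `^ r * k.
Proof.
move=> k0 kK r0; rewrite -powR_mul_add ?addr_gt0// powRr1// mulrC ler_wpM2r//.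
by rewrite ge0_ler_powR ?nnegrE ?(ltW r0) ?(le_trans k0 kK).
Qed.

(** The power [p] makes [cutoff n] the weight produced by applying the
Faber-Krahn inequality to a product with [tent n]. *)
Definition cutoff n x : R := tent G x0 n%:R x `^ p.

Lemma cutoff_ge0 n x : 0 <= cutoff n x. Proof. exact: powR_ge0. Qed.

Lemma cutoff_le1 n x : (0 < n)%N -> cutoff n x <= 1.
Proof.
move=> n0; have E : 1 `^ p = 1 :> R by rewrite powR1.
rewrite /cutoff -[leRHS]E ge0_ler_powR ?nnegrE ?tent_ge0 ?tent_le1 ?ltr0n ?(ltW p_gt0)//.
Qed.

Lemma powR_lipschitz (k l : R) : 0 <= k <= 1 -> 0 <= l <= 1 -> `|k `^ p - l `^ p| <= p * `|k - l|.
Proof.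
wlog lk : k l / l <= k => [H|] k01 l01.
  have [/H->//|/ltW/H] := leP l k.
  by rewrite distrC (distrC k) => ->.
case/andP: k01 => k0 k1; case/andP: l01 => l0 l1.
have lkp : l `^ p <= k `^ p by rewrite ge0_ler_powR ?nnegrE ?(ltW p_gt0).
rewrite !ger0_norm ?subr_ge0//.
apply: (le_trans (powR_sub_le l0 lk ltr01 (ltW p1))).
rewrite divr1 ler_pM2l ?p_gt0// !powRr1// ler_piMl ?subr_ge0//.
have E : 1 `^ (p - 1) = 1 :> R by rewrite powR1.
by rewrite -[leRHS]E ge0_ler_powR ?nnegrE ?subr_ge0 ?(ltW p1).
Qed.

Lemma cutoff_lipschitz n x y : (0 < n)%N -> 0 < G x y ->
  `|cutoff n y - cutoff n x| <= p / n%:R.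
Proof.
move=> n0 xy; have n0' : (0 : R) < n%:R by rewrite ltr0n.
apply: le_trans (powR_lipschitz _ _) _; rewrite ?tent_ge0 ?tent_le1//.
by rewrite ler_pM2l ?p_gt0// tent_lipschitz.
Qed.

Lemma cutoff_supported n (f : V -> R) : (0 < n)%N ->
  (forall x, f x != 0 -> cutoff n x != 0) -> supported G f (ball_seq G x0 n).
Proof.
move=> n0 H; apply: tent_supported => // x /H; apply: contra => /eqP t0.
by rewrite /cutoff t0 powR0// gt_eqF ?p_gt0.
Qed.

(** Absolute value of the flux of [v] across the edge [x y], per unit of edge
weight. *)
Definition flux v x y : R := `|spow (v y) q - spow (v x) q| `^ (p - 1).
Definition energy_density v x y : R :=
  flux v x y * `|spow (v y) th - spow (v x) th|.
Definition cutoff_energy n v : R :=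
  \sum_(x <- ball_seq G x0 n) \sum_(y <- ball_seq G x0 n)
    ((cutoff n x + cutoff n y) / 2 * energy_density v x y) * G x y.
Definition cutoff_moment n v : R :=
  \sum_(x <- ball_seq G x0 n) cutoff n x * (`|v x| `^ (1 + th) * mu G x).

Lemma flux_ge0 v x y : 0 <= flux v x y. Proof. exact: powR_ge0. Qed.
Lemma energy_density_ge0 v x y : 0 <= energy_density v x y.
Proof. by rewrite mulr_ge0 ?flux_ge0. Qed.
Lemma cutoff_energy_ge0 n v : 0 <= cutoff_energy n v.
Proof.
apply: sumr_ge0 => x _; apply: sumr_ge0 => y _.
by rewrite mulr_ge0 ?weight_ge0// mulr_ge0 ?energy_density_ge0// divr_ge0 ?addr_ge0 ?cutoff_ge0.
Qed.
Lemma cutoff_moment_ge0 n v : 0 <= cutoff_moment n v.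
Proof. by apply: sumr_ge0 => x _; rewrite !mulr_ge0 ?cutoff_ge0 ?powR_ge0 ?mu_ge0. Qed.

Lemma norm_flux (D : R) : `| `|D| `^ (p - 2) * D| = `|D| `^ (p - 1).
Proof.
rewrite normrM (ger0_norm (powR_ge0 _ _)) mulrC.
by rewrite -(@mulr_powRB1 _ _ (p - 1)) ?subr_gt0//; congr (_ * _ `^ _); ring.
Qed.

(** When the increments [D] and [d] have the same sign, as increments of two
increasing functions of [v] do, no cancellation occurs. *)
Lemma flux_mul (D d : R) : 0 <= D * d ->
  `|D| `^ (p - 2) * D * d = `|D| `^ (p - 1) * `|d|.
Proof.
move=> Dd; rewrite -norm_flux -normrM ger0_norm// -mulrA mulr_ge0 ?powR_ge0//.
Qed.

(** Testing with [cutoff n * v^th]: the increment of the product splits into the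
averaged cutoff times the increment of [v^th], which yields the energy, and the
averaged [v^th] times the increment of the cutoff.  The latter is [O(1 / n)]
times the flux times [`|v| `^ th], which is summable as [v] is bounded and
summable. *)
Lemma dissipation_le (M : R) : 0 < M -> exists2 C : R, 0 < C &
  forall n v, (0 < n)%N -> l1_le M v ->
  \sum_(x <- ball_seq G x0 n) (cutoff n x * spow (v x) th) *
     (mu G x * plaplacian G p (fun y => spow (v y) q) x) <=
  - 2^-1 * cutoff_energy n v + C / n%:R.
Proof.
move=> M0; have [K K0 HK] := l1_le_sup M0.
pose C0 := 2 `^ (p - 1) * K `^ a * K `^ th.
have C00 : 0 < C0 by rewrite /C0 !mulr_gt0 ?powR_gt0.
exists (C0 * p * M); first by apply: mulr_gt0 => //; apply: mulr_gt0 => //; exact: p_gt0.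
move=> n v n0 Mv; have n0' : (0 : R) < n%:R by rewrite ltr0n.
have sup := HK v Mv; set s := ball_seq G x0 n.
have us : uniq s := ball_seq_uniq G x0 n.
rewrite green//; last first.
  by apply: cutoff_supported => // x; apply: contra => /eqP->; rewrite mul0r.
have H : cutoff_energy n v - C0 * p / n%:R * (\sum_(x <- s) \sum_(y <- s) (`|v x| + `|v y|) * G x y) <=
   \sum_(x <- s) \sum_(y <- s) `|spow (v y) q - spow (v x) q| `^ (p - 2) *
    (spow (v y) q - spow (v x) q) *
    (cutoff n y * spow (v y) th - cutoff n x * spow (v x) th) * G x y.
  rewrite mulr_sumr -sumrB; apply: ler_sum => x _.
  rewrite mulr_sumr -sumrB; apply: ler_sum => y _.
  rewrite [X in _ - X <= _]mulrA -mulrBl.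
  have [Gxy|Gxy] := ltP 0 (G x y); last first.
    have -> : G x y = 0 by apply/eqP; rewrite eq_le Gxy weight_ge0.
    by rewrite !mulr0.
  rewrite ler_pM2r//; set D := spow (v y) q - _; set d := spow (v y) th - spow (v x) th.
  have Dd : 0 <= D * d by apply: spow_sub_mul_ge0; rewrite ?q0 ?th_gt0.
  have -> : `|D| `^ (p - 2) * D * (cutoff n y * spow (v y) th - cutoff n x * spow (v x) th) =
    (cutoff n x + cutoff n y) / 2 * (`|D| `^ (p - 2) * D * d) +
    (`|D| `^ (p - 2) * D) * ((cutoff n y - cutoff n x) * ((spow (v y) th + spow (v x) th) / 2)).
    by rewrite /d; field.
  rewrite (flux_mul Dd) -/(flux v x y) -/(energy_density v x y) lerD2l.
  rewrite lerNl; apply: le_trans (ler_norm _) _; rewrite normrN normrM norm_flux.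
  rewrite -/(flux v x y) normrM.
  have fl : flux v x y <= 2 `^ (p - 1) * K `^ a * (`|v x| + `|v y|).
    have fm := flux_le_max (v y) (v x) p1 q0.
    have qp : q * (p - 1) = 1 + a by ring.
    rewrite qp in fm; apply: (le_trans fm).
    rewrite -mulrA [X in _ * X <= _]addrC ler_pM2l ?powR_gt0// [leRHS]mulrDr.
    by rewrite lerD// powR_le_linear ?normr_ge0 ?a_gt0.
  have wl : `|(spow (v y) th + spow (v x) th) / 2| <= K `^ th.
    rewrite normrM (@ger0_norm _ 2^-1) ?invr_ge0// ler_pdivrMr//.
    apply: le_trans (ler_normD _ _) _; rewrite !normr_spow ?th_gt0// mulr_natr mulr2n.
    by rewrite lerD// ge0_ler_powR ?nnegrE ?(ltW th_gt0) ?(ltW K0).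
  apply: (@le_trans _ _ (2 `^ (p - 1) * K `^ a * (`|v x| + `|v y|) * (p / n%:R * K `^ th))).
    apply: ler_pM; rewrite ?flux_ge0 ?mulr_ge0//.
    by apply: ler_pM => //; exact: cutoff_lipschitz.
  by rewrite le_eqVlt /C0; apply/orP; left; apply/eqP; ring.
have S : \sum_(x <- s) \sum_(y <- s) (`|v x| + `|v y|) * G x y <= 2 * M.
  apply: le_trans (sum_pair_le _ us (fun x => normr_ge0 (v x))) _.
  by rewrite ler_pM2l// Mv.
have cn : 0 <= C0 * p / n%:R by rewrite divr_ge0 ?(ltW n0')// mulr_ge0 ?(ltW C00) ?(ltW p_gt0).
have := ler_wpM2l cn S.
have -> : C0 * p / n%:R * (2 * M) = 2 * (C0 * p * M / n%:R) by ring.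
move: H; rewrite -/s; lra.
Qed.

Lemma powR_add_le (k l : R) : 0 <= k -> 0 <= l ->
  (k + l) `^ p <= 2 `^ p * (k `^ p + l `^ p).
Proof.
move=> k0 l0; have m0 : 0 <= Num.max k l by rewrite le_max k0.
apply: (@le_trans _ _ ((2 * Num.max k l) `^ p)).
  rewrite ge0_ler_powR ?nnegrE ?addr_ge0 ?mulr_ge0 ?(ltW p_gt0)//.
  by rewrite mulr_natl mulr2n lerD// le_max lexx ?orbT.
rewrite powRM// ler_wpM2l ?powR_ge0//.
by rewrite /Num.max; case: ifP => _; rewrite ?lerDl ?lerDr powR_ge0.
Qed.

Lemma max0_sub_lipschitz (k A B : R) :
  `|Num.max 0 (A - k) - Num.max 0 (B - k)| <= `|A - B|.
Proof.
rewrite /Num.max; case: ltP => h1; case: ltP => h2.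
- by rewrite (_ : _ - _ = A - B)//; ring.
- rewrite subr0 !ger0_norm; lra.
- rewrite sub0r normrN [leRHS]distrC !ger0_norm; lra.
- by rewrite subrr normr0.
Qed.

(** Vertices with [`|v x| <= 2 * k] contribute at most [(2 * k) `^ th * M] to the
moment.  At the others the truncation [g] of [`|v| `^ ga] at height [k `^ ga]
is comparable to [`|v| `^ ga], so that their contribution is at most a constant
times [k `^ (- a)] times the sum of [g `^ p].  The Faber-Krahn inequality for [tent n * g], whose
support has measure at most [M / k], bounds that sum by the energy. *)
Lemma nash_le (M : R) : 0 < M -> exists2 c : R, 0 < c & exists2 C : R, 0 < C &
  forall n v k, (0 < n)%N -> l1_le M v -> 0 < k ->
  c * (k `^ a * Lam (M / k) * (cutoff_moment n v - (2 * k) `^ th * M)) <= cutoff_energy n v + C / n%:R.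
Proof.
move=> M0; have [K K0 HK] := l1_le_sup M0.
pose c0 := (1 - 2 `^ (- ga)) `^ p.
have g1 : 2 `^ (- ga) < 1 :> R.
  have E : 1 `^ ga = 1 :> R by rewrite powR1.
  by rewrite powRN invf_lt1 ?powR_gt0// -[ltLHS]E gt0_ltr_powR ?nnegrE ?ga_gt0 ?ltr1n.
have c00 : 0 < c0 by rewrite powR_gt0// subr_gt0.
pose A := 2 `^ p * (2 * (ga / th)); pose B := 2 `^ p * (K `^ (a + th) * (2 * M)).
have A0 : 0 < A.
  by rewrite mulr_gt0 ?powR_gt0// mulr_gt0// divr_gt0 ?ga_gt0 ?th_gt0.
have B0 : 0 < B by rewrite mulr_gt0 ?powR_gt0// mulr_gt0 ?powR_gt0// mulr_gt0.
exists (c0 / A); first exact: divr_gt0.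
exists (B / A); first exact: divr_gt0.
move=> n v k n0 Mv k0; have n0' : (0 : R) < n%:R by rewrite ltr0n.
have sup := HK v Mv; set s := ball_seq G x0 n.
have us : uniq s := ball_seq_uniq G x0 n.
pose g x := Num.max 0 (`|v x| `^ ga - k `^ ga).
have g0 x : 0 <= g x by rewrite /g le_max lexx.
have gle x : g x <= `|v x| `^ ga.
  by rewrite /g ge_max powR_ge0 gerBl powR_ge0.
have gk x : g x != 0 -> k <= `|v x|.
  apply: contraNT; rewrite -ltNge => vk; apply/eqP/max_idPl.
  by rewrite subr_le0 ge0_ler_powR ?nnegrE ?(ltW ga_gt0) ?(ltW k0) ?(ltW vk).
have gp x : g x `^ p <= K `^ (a + th) * `|v x|.
  apply: (@le_trans _ _ ((`|v x| `^ ga) `^ p)).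
    by rewrite ge0_ler_powR ?nnegrE ?powR_ge0 ?(ltW p_gt0).
  by rewrite -powRrM (mulrC ga) p_gaE powR_le_linear ?normr_ge0 ?(addr_gt0 a_gt0 th_gt0) ?sup.
pose f x := tent G x0 n%:R x * g x.
have f0 x : 0 <= f x by rewrite mulr_ge0 ?tent_ge0.
have fp x : `|f x| `^ p = cutoff n x * g x `^ p.
  by rewrite ger0_norm// powRM ?tent_ge0.
have fs : supported G f s.
  by apply: tent_supported => // x; apply: contra => /eqP; rewrite /f => ->; rewrite mul0r.
have Mk : 0 < M / k by exact: divr_gt0.
have fmu : \sum_(x <- s | f x != 0) mu G x <= M / k.
  rewrite ler_pdivlMr// mulr_suml; apply: le_trans (Mv s us).
  rewrite big_mkcond/=; apply: ler_sum => x _.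
  case: ifPn => [fx|_]; last by rewrite mulr_ge0 ?mu_ge0.
  rewrite mulrC ler_wpM2r ?mu_ge0// gk//.
  by apply: contra fx => /eqP; rewrite /f => ->; rewrite mulr0.
have FK := faber_krahn_seq hLam hFK p_gt0 us fs Mk fmu.
have L0 : 0 < Lam (M / k) by exact: Lam_gt0 hLam _ _.
have up : \sum_(x <- s) \sum_(y <- s) `|f y - f x| `^ p * G x y <=
    A * cutoff_energy n v + B / n%:R.
  have np : n%:R^-1 `^ p <= n%:R^-1 :> R.
    by rewrite ge1r_powR ?invr_gt0 ?n0'/= ?invf_le1 ?ler1n// ltW.
  have pt x y : `|f y - f x| `^ p * G x y <=
      A * ((cutoff n x + cutoff n y) / 2 * energy_density v x y * G x y) +
      2 `^ p * (K `^ (a + th) / n%:R * ((`|v x| + `|v y|) * G x y)).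
    have [Gxy|Gxy] := ltP 0 (G x y); last first.
      have -> : G x y = 0 by apply/eqP; rewrite eq_le Gxy weight_ge0.
      by rewrite !mulr0 addr0.
    rewrite (_ : A * _ + _ = (A * ((cutoff n x + cutoff n y) / 2 * energy_density v x y) +
      2 `^ p * (K `^ (a + th) / n%:R * (`|v x| + `|v y|))) * G x y); last by ring.
    rewrite ler_pM2r//.
    have h1 : `|f y - f x| <= tent G x0 n%:R y * `|g y - g x| + n%:R^-1 * g x.
      rewrite (_ : f y - f x = tent G x0 n%:R y * (g y - g x) +
        (tent G x0 n%:R y - tent G x0 n%:R x) * g x); last by rewrite /f; ring.
      apply: le_trans (ler_normD _ _) _; rewrite !normrM.
      rewrite (ger0_norm (tent_ge0 _ _ _ _)) (ger0_norm (g0 x)) lerD2l.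
      by rewrite ler_wpM2r// tent_lipschitz.
    apply: (@le_trans _ _ ((tent G x0 n%:R y * `|g y - g x| + n%:R^-1 * g x) `^ p)).
      by rewrite ge0_ler_powR ?nnegrE ?(ltW p_gt0) ?addr_ge0 ?mulr_ge0 ?tent_ge0 ?invr_ge0.
    apply: le_trans (powR_add_le _ _) _; rewrite ?mulr_ge0 ?tent_ge0 ?invr_ge0//.
    rewrite (_ : A * _ + _ = 2 `^ p *
      ((cutoff n x + cutoff n y) * (ga / th * energy_density v x y) +
       K `^ (a + th) / n%:R * (`|v x| + `|v y|))); last first.
      by rewrite /A; move: (ga / th) => z; field; rewrite gt_eqF.
    rewrite ler_pM2l ?powR_gt0//; apply: lerD.
      rewrite powRM ?tent_ge0// -/(cutoff n y).
      have h2 : `|g y - g x| `^ p <= ga / th * energy_density v x y.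
        apply: le_trans (stroock_varopoulos _ _ p1 th_gt0 th_le_ga ga_le_q p_ga).
        by rewrite ge0_ler_powR ?nnegrE ?(ltW p_gt0) ?max0_sub_lipschitz.
      by apply: ler_pM; rewrite ?cutoff_ge0 ?powR_ge0// lerDr cutoff_ge0.
    rewrite powRM ?invr_ge0//.
    rewrite (_ : _ / n%:R * _ = n%:R^-1 * (K `^ (a + th) * (`|v x| + `|v y|))); last by ring.
    apply: ler_pM; rewrite ?powR_ge0//; apply: le_trans (gp x) _.
    by rewrite ler_pM2l ?powR_gt0// lerDl.
  apply: (@le_trans _ _ (A * cutoff_energy n v + 2 `^ p * (K `^ (a + th) / n%:R *
      \sum_(x <- s) \sum_(y <- s) (`|v x| + `|v y|) * G x y))).
    rewrite /cutoff_energy -/s !mulr_sumr -big_split/=; apply: ler_sum => x _.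
    by rewrite !mulr_sumr -big_split/=; apply: ler_sum => y _; exact: pt.
  have S : \sum_(x <- s) \sum_(y <- s) (`|v x| + `|v y|) * G x y <= 2 * M.
    apply: le_trans (sum_pair_le _ us (fun x => normr_ge0 (v x))) _.
    by rewrite ler_pM2l// Mv.
  rewrite lerD2l /B -!mulrA ler_pM2l ?powR_gt0// ler_pM2l ?powR_gt0// mulrC.
  by rewrite !mulrA ler_pM2r ?invr_gt0.
have low : c0 * k `^ a * (cutoff_moment n v - (2 * k) `^ th * M) <= \sum_(x <- s) `|f x| `^ p * mu G x.
  have pt x : c0 * k `^ a * (cutoff n x * (`|v x| `^ (1 + th) * mu G x)) <=
      c0 * k `^ a * ((2 * k) `^ th * (`|v x| * mu G x)) + `|f x| `^ p * mu G x.
    rewrite fp.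
    have -> : c0 * k `^ a * (cutoff n x * (`|v x| `^ (1 + th) * mu G x)) =
      (c0 * k `^ a * (cutoff n x * `|v x| `^ (1 + th))) * mu G x by ring.
    have -> : c0 * k `^ a * ((2 * k) `^ th * (`|v x| * mu G x)) +
        cutoff n x * g x `^ p * mu G x =
      (c0 * k `^ a * ((2 * k) `^ th * `|v x|) + cutoff n x * g x `^ p) * mu G x by ring.
    apply: ler_wpM2r; first exact: mu_ge0.
    have ck0 : 0 < c0 * k `^ a by exact: mulr_gt0 c00 (powR_gt0 _ k0).
    have [v2k|v2k] := leP `|v x| (2 * k).
      rewrite -[leLHS]addr0 lerD ?mulr_ge0 ?cutoff_ge0 ?powR_ge0// ler_pM2l//.
      apply: (@le_trans _ _ (`|v x| `^ (1 + th))).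
        by rewrite ler_piMl ?powR_ge0 ?cutoff_le1.
      by rewrite powR_le_linear ?th_gt0.
    rewrite -[leLHS]add0r lerD//.
      by rewrite !mulr_ge0 ?powR_ge0 ?(ltW c00).
    rewrite mulrCA ler_wpM2l ?cutoff_ge0//.
    have v0 : 0 < `|v x| by apply: lt_trans v2k; rewrite mulr_gt0.
    have gl : (1 - 2 `^ (- ga)) * `|v x| `^ ga <= g x.
      rewrite /g le_max; apply/orP; right; rewrite mulrBl mul1r lerD2l lerN2.
      rewrite powRN ler_pdivlMl ?powR_gt0// -powRM ?(ltW k0)//.
      by rewrite ge0_ler_powR ?nnegrE ?(ltW ga_gt0) ?mulr_ge0 ?(ltW k0) ?(ltW v2k).
    apply: (@le_trans _ _ (((1 - 2 `^ (- ga)) * `|v x| `^ ga) `^ p)); last first.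
      by rewrite ge0_ler_powR ?nnegrE ?(ltW p_gt0) ?mulr_ge0 ?powR_ge0 ?subr_ge0 ?(ltW g1).
    rewrite powRM ?powR_ge0 ?subr_ge0 ?(ltW g1)// -/c0 -mulrA ler_pM2l//.
    rewrite -powRrM [leLHS]mulrC (mulrC ga) p_gaE (_ : 1 + (a + th) = (1 + th) + a); last by ring.
    rewrite [leRHS]powRD ?(gt_eqF v0) ?implybT// ler_pM2l ?powR_gt0//.
    rewrite ge0_ler_powR ?nnegrE ?(ltW a_gt0) ?(ltW k0)//.
    apply: le_trans (ltW v2k); rewrite mulr_natl mulr2n lerDl ltW//.
  rewrite mulrBr lerBlDl.
  apply: (@le_trans _ _ (c0 * k `^ a * ((2 * k) `^ th * \sum_(x <- s) `|v x| * mu G x) +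
      \sum_(x <- s) `|f x| `^ p * mu G x)).
    rewrite /cutoff_moment -/s !mulr_sumr -big_split/=; apply: ler_sum => x _.
    exact: pt.
  rewrite lerD2r ler_wpM2l ?mulr_ge0 ?powR_ge0 ?(ltW c00)// ler_wpM2l ?powR_ge0//.
  exact: Mv.
rewrite -(ler_pM2l A0) [leRHS]mulrDr.
have -> : A * (B / A / n%:R) = B / n%:R by field; rewrite !gt_eqF.
apply: le_trans up; apply: le_trans FK.
have -> : A * (c0 / A * (k `^ a * Lam (M / k) * (cutoff_moment n v - (2 * k) `^ th * M))) =
  Lam (M / k) * (c0 * k `^ a * (cutoff_moment n v - (2 * k) `^ th * M)) by field; rewrite gt_eqF.
by rewrite ler_pM2l.
Qed.

End Static.

(** * Evolution of moments and of mass *)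

Lemma sum_subset_le (R : realType) (T : eqType) (s s' : seq T) (h : T -> R) :
  uniq s -> uniq s' -> {subset s <= s'} -> (forall x, 0 <= h x) ->
  \sum_(x <- s) h x <= \sum_(x <- s') h x.
Proof.
move=> us us' ss' h0; rewrite [leRHS](bigID (mem s))/=.
rewrite -[X in _ <= X + _]big_filter [X in _ <= X + _](perm_big s)/=.
  by rewrite lerDl sumr_ge0.
apply: uniq_perm; rewrite ?filter_uniq// => x; rewrite mem_filter.
by case: (boolP (x \in s)) => //= /ss'.
Qed.

Lemma exists_nat_gt (R : realType) (y : R) : exists2 n : nat, (0 < n)%N & y < n%:R.
Proof.
have := archi_boundP (normr_ge0 y); set n := Num.bound _ => yn.
exists n.+1 => //; apply: le_lt_trans (ler_norm y) _; apply: lt_trans yn _.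
by rewrite ltr_nat.
Qed.

Section Evolution.
Context {R : realType} {V : countType} (G : wgraph R V) (x0 : V).
Context (p q : R) (Lam : R -> R).
Hypotheses (p1 : 1 < p) (q0 : 0 < q) (hpq : 1 < q * (p - 1)).
Hypotheses (hLam : FK_function p Lam) (hFK : faber_krahn G p Lam).
Context (T : \bar R) (u0 : V -> R) (u : V -> R -> R).
Hypothesis hu : is_solution G p q T u0 u.
Context (M : R).
Hypotheses (M0 : 0 < M) (hM : forall t s, 0 <= t -> (t%:E < T)%E -> uniq s ->
    \sum_(x <- s) `|u x t| * mu G x <= M).
Implicit Types (n : nat) (x y : V) (t r la : R).
Local Notation a := (q * (p - 1) - 1).
Local Notation th := (a / p).
Local Notation moment := (cutoff_moment G x0 p q).
Local Notation energy := (cutoff_energy G x0 p q).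
Local Notation eta := (cutoff G x0 p).
Local Notation vball := (ball_seq G x0).
Local Notation phi := (phi1 p q Lam).

Let th0 : 0 < th. Proof. exact: th_gt0. Qed.
Let p0 : 0 < p. Proof. exact: p_gt0. Qed.

Definition dissipation n t : R :=
  \sum_(x <- vball n) (eta n x * spow (u x t) th) *
     (mu G x * plaplacian G p (fun y => spow (u y t) q) x).

Definition power_sum n t : R := \sum_(x <- vball n) `|u x t| `^ (1 + th) * mu G x.

Lemma moment_derive n t : 0 < t -> (t%:E < T)%E ->
  is_derive t 1 (fun t => moment n (u^~ t)) ((1 + th) * dissipation n t).
Proof.
move=> t0 tT; have [_ _ du _] := hu.
rewrite /dissipation mulr_sumr; apply: is_derive_sum_seq => x.
have s1 : 1 < 1 + th by rewrite ltrDl.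
have d1 := @is_derive1_comp _ _ _ _ _ _ (is_derive_norm_powR (u x t) s1) (du x t t0 tT).
have -> : (fun t => eta n x * (`|u x t| `^ (1 + th) * mu G x)) =
   (eta n x * mu G x) *: ((fun z : R => `|z| `^ (1 + th)) \o u x).
  apply/funext => s; rewrite -[RHS]/(eta n x * mu G x * `|u x s| `^ (1 + th)).
  by ring.
have -> : (1 + th) * (eta n x * spow (u x t) th *
      (mu G x * plaplacian G p (fun y => spow (u y t) q) x)) =
   (eta n x * mu G x) *: ((1 + th) * spow (u x t) (1 + th - 1) *
      plaplacian G p (fun y => spow (u y t) q) x).
  by rewrite (_ : 1 + th - 1 = th) ?scalerAl; [rewrite /GRing.scale/=; ring|ring].
exact: is_deriveZ.
Qed.

Lemma moment_le_power_sum n t : (0 < n)%N -> moment n (u^~ t) <= power_sum n t.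
Proof.
move=> n0; apply: ler_sum => x _.
by rewrite ler_piMl ?cutoff_le1// mulr_ge0 ?powR_ge0 ?mu_ge0.
Qed.

(** By [dissipation_le] and [nash_le] the moment satisfies the hypotheses of
[ode_decay] with an error [e] of order [1 / n]. *)
Lemma moment_decay (m : R) : 0 < m -> exists2 C : R, 0 < C &
  forall n t, (0 < n)%N -> 0 < t -> (t%:E < T)%E ->
  moment n (u^~ t) <= C * phi (t^-1 * m) `^ th + C / n%:R * t.
Proof.
move=> m0.
have [Cd Cd0 Hd] := dissipation_le G x0 p1 q0 hpq M0.
have [c c0 [Cn Cn0 Hn]] := nash_le x0 p1 q0 hpq hLam hFK M0.
have th1 : 0 < 1 + th by rewrite addr_gt0.
have c'0 : 0 < (1 + th) * c / 2 by rewrite divr_gt0// mulr_gt0.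
have [C C0 HC] := ode_decay p1 hpq hLam M0 c'0 m0.
pose e : R := (1 + th) * (Cn + Cd).
have e0 : 0 < e by rewrite mulr_gt0 ?addr_gt0.
exists (C + e); first exact: addr_gt0.
move=> n t n0 t0 tT; have n0' : (0 : R) < n%:R by rewrite ltr0n.
apply: (@le_trans _ _ (C * phi (t^-1 * m) `^ th + e / n%:R * t)); last first.
  apply: lerD; first by rewrite ler_wpM2r ?powR_ge0// lerDl ltW.
  by rewrite ler_pM2r// ler_pM2r ?invr_gt0// lerDr ltW.
apply: (HC (fun t => moment n (u^~ t))) => //; first by rewrite divr_ge0// ltW.
move=> tau tau0 taut.
have tauT : (tau%:E < T)%E by apply: le_lt_trans tT; rewrite lee_fin.
exists ((1 + th) * dissipation n tau); first exact: moment_derive.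
have L1 : l1_le G M (u^~ tau) by move=> s us; apply: hM => //; exact: ltW.
have Dd := Hd n _ n0 L1; rewrite -/(dissipation n tau) in Dd.
have en : e / n%:R = (1 + th) * (Cn / n%:R + Cd / n%:R) by rewrite /e; ring.
have cn : 0 < Cn / n%:R by rewrite divr_gt0.
have cd : 0 < Cd / n%:R by rewrite divr_gt0.
have E0 := cutoff_energy_ge0 G x0 p q n (u^~ tau).
rewrite en; split; first by rewrite ler_pM2l//; lra.
move=> k k0 /=; have := Hn n _ k n0 L1 k0.
set X := _ * (moment _ _ - _) => HX.
have -> : (1 + th) * (Cn / n%:R + Cd / n%:R) - (1 + th) * c / 2 * X =
    (1 + th) * (Cn / n%:R + Cd / n%:R - c / 2 * X) by ring.
rewrite ler_pM2l//; lra.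
Qed.

(** On the ball of radius [n] the weights [cutoff N] with [2 * n <= N] are at least
[2 `^ (- p)]; letting [N] tend to infinity removes the error in
[moment_decay]. *)
Lemma power_sum_decay (m : R) : 0 < m -> exists2 C : R, 0 < C &
  forall n t, 0 < t -> (t%:E < T)%E -> power_sum n t <= C * phi (t^-1 * m) `^ th.
Proof.
move=> m0; have [C C0 HC] := moment_decay m0.
have P : 0 < 2 `^ p :> R by rewrite powR_gt0.
exists (2 `^ p * C); first exact: mulr_gt0.
move=> n t t0 tT; apply/ler_addgt0Pr => e e0.
have [N N0 HN] := exists_nat_gt (2 * n%:R + 2 `^ p * C * t / e).
have N0' : (0 : R) < N%:R by rewrite ltr0n.
have K0 : 0 <= 2 `^ p * C * t / e by rewrite !mulr_ge0 ?invr_ge0 ?(ltW P) ?(ltW C0) ?(ltW t0) ?(ltW e0).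
have n0' : (0 : R) <= n%:R by [].
apply: (@le_trans _ _ (2 `^ p * moment N (u^~ t))).
  rewrite /power_sum /cutoff_moment mulr_sumr.
  apply: (@le_trans _ _ (\sum_(x <- vball n) 2 `^ p * (eta N x * (`|u x t| `^ (1 + th) * mu G x)))).
    rewrite big_seq [leRHS]big_seq; apply: ler_sum => x; rewrite mem_ball_seq => xn.
    rewrite mulrA ler_peMl ?mulr_ge0 ?powR_ge0 ?mu_ge0//.
    have te : 1 <= 2 * tent G x0 N%:R x.
      have : 1 - (gdist G x x0)%:R / N%:R <= tent G x0 N%:R x by rewrite /tent le_max lexx orbT.
      have : (gdist G x x0)%:R / N%:R <= 1 / 2 :> R.
        rewrite ler_pdivrMr// (@le_trans _ _ n%:R)// ?ler_nat//.
        by move: HN K0; lra.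
      lra.
    have E : 1 `^ p = 1 :> R by rewrite powR1.
    rewrite /cutoff -powRM ?tent_ge0// -[leLHS]E ge0_ler_powR ?nnegrE ?mulr_ge0 ?tent_ge0 ?(ltW p0)//.
  apply: sum_subset_le; rewrite ?ball_seq_uniq//.
    move=> x; rewrite !mem_ball_seq => /leq_trans; apply.
    by rewrite -(ler_nat R); move: HN K0 n0'; lra.
  by move=> x; rewrite !mulr_ge0 ?cutoff_ge0 ?powR_ge0 ?mu_ge0.
rewrite -mulrA.
apply: (@le_trans _ _ (2 `^ p * (C * phi (t^-1 * m) `^ th + C / N%:R * t))).
  by rewrite ler_pM2l// HC.
rewrite mulrDr lerD2l.
have -> : 2 `^ p * (C / N%:R * t) = 2 `^ p * C * t / N%:R by ring.
rewrite ler_pdivrMr//.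
have : 2 `^ p * C * t / e <= N%:R by move: HN n0'; lra.
by rewrite ler_pdivrMr// [N%:R * e]mulrC.
Qed.

(** Test function for the mass: its scale [r] is that of the ball in the theorem,
whereas the scale [n] of [cutoff n] tends to infinity. *)
Definition plateau r x : R := Num.min 1 (2 * tent G x0 r x).

Lemma plateau_ge0 r x : 0 <= plateau r x.
Proof. by rewrite /plateau le_min ler01 mulr_ge0 ?tent_ge0. Qed.

Lemma plateau_le1 r x : plateau r x <= 1.
Proof. by rewrite /plateau ge_min lexx. Qed.

Lemma plateau_lipschitz r x y : 0 < r -> 0 < G x y ->
  `|plateau r y - plateau r x| <= 2 / r.
Proof.
move=> r0 xy; have := tent_lipschitz x0 r0 xy.
set A := tent _ _ _ y; set B := tent _ _ _ x.
rewrite ler_norml => /andP[h1 h2].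
have ri : 0 < r^-1 by rewrite invr_gt0.
rewrite /plateau -/A -/B /Num.min ler_norml.
by case: ltP => h3; case: ltP => h4; apply/andP; split; lra.
Qed.

Lemma plateau_eq1 r x : 0 < r -> (gdist G x x0)%:R <= r / 2 -> plateau r x = 1.
Proof.
move=> r0 xr; apply/min_idPl; rewrite /tent.
have : (gdist G x x0)%:R / r <= 1 / 2.
  by rewrite ler_pdivrMr//; lra.
have : 1 - (gdist G x x0)%:R / r <= Num.max 0 (1 - (gdist G x x0)%:R / r).
  by rewrite le_max lexx orbT.
lra.
Qed.

Lemma plateau_neq0 r x : 0 < r -> plateau r x != 0 -> (gdist G x x0)%:R < r.
Proof.
move=> r0; rewrite ltNge; apply: contra => /(tent_eq0 r0) t0.
by rewrite /plateau t0 mulr0 /Num.min ltNge ler01.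
Qed.

(** Only edges along which [plateau r] changes contribute.  They meet the ball of
radius [r], on which [cutoff n] is bounded below since [2 * r <= n], so that
the dissipation part of [flux_le] is controlled by the weighted energy. *)
Lemma mass_flux : exists2 A : R, 0 < A &
  forall r n la (v : V -> R), 0 < r -> 2 * r <= n%:R -> 0 < la ->
  - (A / r * (la * energy n v + la `^ (1 - p) *
       \sum_(x <- vball n) `|v x| `^ (1 + th) * mu G x)) <=
  \sum_(x <- vball n) plateau r x * (mu G x * plaplacian G p (fun y => spow (v y) q) x).
Proof.
have qth := q_sub_th q p1.
pose C : R := (2 * (q / th)) `^ (p - 1).
have C0 : 0 < C by rewrite powR_gt0// mulr_gt0// divr_gt0.
have P : 0 < 2 `^ (p + 1) :> R by rewrite powR_gt0.
exists (2 `^ (p + 1) + 2 * C); first by rewrite addr_gt0// mulr_gt0.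
move=> r n la v r0 rn la0.
have n0' : (0 : R) < n%:R by lra.
have n0 : (0 < n)%N by rewrite -(ltr0n R).
set s := vball n; have us : uniq s := ball_seq_uniq G x0 n.
rewrite green//; last first.
  move=> x /(plateau_neq0 r0) xr; apply: ball_seq_interior.
  by rewrite -(ltr_nat R); lra.
rewrite mulNr lerN2.
have pt x y : `|spow (v y) q - spow (v x) q| `^ (p - 2) * (spow (v y) q - spow (v x) q) *
    (plateau r y - plateau r x) * G x y <=
    2 / r * (la * 2 `^ (p + 1) * ((eta n x + eta n y) / 2 * energy_density p q v x y * G x y)
     + C * la `^ (1 - p) * ((`|v x| `^ (1 + th) + `|v y| `^ (1 + th)) * G x y)).
  have -> : 2 / r * (la * 2 `^ (p + 1) * ((eta n x + eta n y) / 2 * energy_density p q v x y * G x y)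
     + C * la `^ (1 - p) * ((`|v x| `^ (1 + th) + `|v y| `^ (1 + th)) * G x y)) =
     2 / r * (la * 2 `^ (p + 1) * ((eta n x + eta n y) / 2 * energy_density p q v x y)
     + C * la `^ (1 - p) * (`|v x| `^ (1 + th) + `|v y| `^ (1 + th))) * G x y by ring.
  have [Gxy|Gxy] := ltP 0 (G x y); last first.
    have -> : G x y = 0 by apply/eqP; rewrite eq_le Gxy weight_ge0.
    by rewrite !mulr0.
  rewrite ler_pM2r//.
  have r2 : 0 < 2 / r by rewrite divr_gt0.
  have ed0 := energy_density_ge0 p q v x y.
  have [D0|D0] := eqVneq (plateau r y - plateau r x) 0.
    rewrite D0 mulr0 mulr_ge0 ?(ltW r2)// addr_ge0//.
      by rewrite mulr_ge0 ?(mulr_ge0 (ltW la0) (ltW P))// mulr_ge0// divr_ge0 ?addr_ge0 ?cutoff_ge0.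
    by rewrite mulr_ge0 ?addr_ge0 ?powR_ge0// mulr_ge0 ?powR_ge0.
  apply: le_trans (ler_norm _) _; rewrite normrM norm_flux// mulrC.
  apply: ler_pM; rewrite ?powR_ge0 ?plateau_lipschitz//.
  have := @flux_le _ p q th la (v y) (v x) p1 th0 (th_le_q p1 q0) la0.
  rewrite qth addr_gt0// => /(_ isT).
  rewrite -/(flux p q v x y) -/(energy_density p q v x y) -/C => H.
  apply: (le_trans H); rewrite [X in _ + C * (_ * X)]addrC; apply: lerD; last by rewrite mulrA.
  rewrite -mulrA ler_pM2l// mulrA ler_peMl//.
  have half x' : plateau r x' != 0 -> 2 `^ p * eta n x' >= 1.
    move=> /(plateau_neq0 r0) xr.
    have te : 1 <= 2 * tent G x0 n%:R x'.
      have : 1 - (gdist G x' x0)%:R / n%:R <= tent G x0 n%:R x' by rewrite /tent le_max lexx orbT.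
      have : (gdist G x' x0)%:R / n%:R <= 1 / 2 :> R.
        by rewrite ler_pdivrMr//; lra.
      lra.
    have E : 1 `^ p = 1 :> R by rewrite powR1.
    by rewrite /cutoff -powRM ?tent_ge0// -[leLHS]E ge0_ler_powR ?nnegrE ?mulr_ge0 ?tent_ge0 ?(ltW p0).
  have -> : 2 `^ (p + 1) * ((eta n x + eta n y) / 2) = 2 `^ p * eta n x + 2 `^ p * eta n y.
    by rewrite powRD ?pnatr_eq0 ?implybT// powRr1//; field.
  have cx : 0 <= 2 `^ p * eta n x by rewrite mulr_ge0 ?powR_ge0 ?cutoff_ge0.
  have cy : 0 <= 2 `^ p * eta n y by rewrite mulr_ge0 ?powR_ge0 ?cutoff_ge0.
  have [px|/half] := eqVneq (plateau r x) 0; last by lra.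
  by move: D0; rewrite px subr0 => /half; lra.
have S : \sum_(x <- s) \sum_(y <- s)
    `|spow (v y) q - spow (v x) q| `^ (p - 2) * (spow (v y) q - spow (v x) q) *
    (plateau r y - plateau r x) * G x y <=
    2 / r * (la * 2 `^ (p + 1) * energy n v + C * la `^ (1 - p) *
     \sum_(x <- s) \sum_(y <- s) (`|v x| `^ (1 + th) + `|v y| `^ (1 + th)) * G x y).
  rewrite /cutoff_energy -/s !mulr_sumr -big_split mulr_sumr/=; apply: ler_sum => x _.
  by rewrite !mulr_sumr -big_split mulr_sumr/=; apply: ler_sum => y _; exact: pt.
have h0 x : 0 <= `|v x| `^ (1 + th) by exact: powR_ge0.
have W0 : 0 <= \sum_(x <- s) `|v x| `^ (1 + th) * mu G x.
  by apply: sumr_ge0 => x _; rewrite mulr_ge0 ?mu_ge0.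
have := sum_pair_le G us h0; move: W0 S.
set W := \sum_(x <- s) (_ * mu G x); set Q := \sum_(x <- s) \sum_(y <- s) (_ + _) * _.
set S := \sum_(x <- s) \sum_(y <- s) _ => W0 SS QW.
have := cutoff_energy_ge0 G x0 p q n v; move: SS; set E := energy n v => SS E0.
have l0 : 0 < la `^ (1 - p) by exact: powR_gt0.
have ri : 0 < r^-1 by rewrite invr_gt0.
have K0 : 0 <= la `^ (1 - p) * W by apply: mulr_ge0 => //; exact: ltW.
have K1 : 0 <= la * E by apply: mulr_ge0 => //; exact: ltW.
have K2 : C * la `^ (1 - p) * Q <= 2 * C * (la `^ (1 - p) * W).
  rewrite (_ : 2 * C * _ = C * la `^ (1 - p) * (2 * W)); last by ring.
  by rewrite ler_pM2l// mulr_gt0.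
have K3 : la * 2 `^ (p + 1) * E + C * la `^ (1 - p) * Q <=
    (2 `^ (p + 1) + 2 * C) * (la * E + la `^ (1 - p) * W).
  have := mulr_ge0 (ltW C0) K1; have := mulr_ge0 (ltW P) K0.
  have -> : la * 2 `^ (p + 1) * E = 2 `^ (p + 1) * (la * E) by ring.
  move: K2; set c1 := C * _ * Q; set c2 := la * E; set c3 := _ * W; set c4 := 2 `^ _.
  by rewrite mulrDl !mulrDr; lra.
have := ler_wpM2l (ltW ri) K3.
have : 2^-1 * S <= r^-1 * (la * 2 `^ (p + 1) * E + C * la `^ (1 - p) * Q).
  by move: SS; rewrite -(@ler_pM2l _ 2^-1) ?invr_gt0// mulrA mulrA mulVf ?mul1r.
move=> h1 h2; apply: (le_trans h1); apply: (le_trans h2).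
by rewrite mulrA (mulrC r^-1).
Qed.


Lemma moment_cvg0 n : (0 < T)%E -> moment n (u^~ t) @[t --> 0^'+] --> moment n (u^~ 0).
Proof.
move=> T0; apply: cvg_sum_seq => x; apply: cvgM; first exact: cvg_cst.
apply: cvgM; last exact: cvg_cst.
have s1 : 1 < 1 + th by rewrite ltrDl.
have c := is_derive_continuous (is_derive_norm_powR (u x 0) s1).
have r := @solution_right_cont _ _ _ _ _ _ _ _ x 0 hu (lexx 0) T0.
exact: (cvg_comp _ _ r c).
Qed.

Lemma mass_cvg0 n r : (0 < T)%E ->
  \sum_(x <- vball n) plateau r x * (u x t * mu G x) @[t --> 0^'+] -->
  \sum_(x <- vball n) plateau r x * (u x 0 * mu G x).
Proof.
move=> T0; apply: cvg_sum_seq => x; apply: cvgM; first exact: cvg_cst.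
apply: cvgM; last exact: cvg_cst.
exact: solution_right_cont hu _ _.
Qed.

Lemma mass_derive n r t : 0 < t -> (t%:E < T)%E ->
  is_derive t 1 (fun t => \sum_(x <- vball n) plateau r x * (u x t * mu G x))
    (\sum_(x <- vball n) plateau r x *
      (mu G x * plaplacian G p (fun y => spow (u y t) q) x)).
Proof.
move=> t0 tT; have [_ _ du _] := hu.
apply: is_derive_sum_seq => x.
have -> : (fun t => plateau r x * (u x t * mu G x)) = (plateau r x * mu G x) *: u x.
  apply/funext => s; rewrite -[RHS]/(plateau r x * mu G x * u x s); ring.
by rewrite mulrA; apply: is_deriveZ; exact: du.
Qed.

Lemma powR_cvg0_right (s : R) : 0 < s -> (t `^ s : R) @[t --> 0^'+] --> (0 : R) `^ s.
Proof. by move=> s0; rewrite powR0 ?gt_eqF//; exact: powR_cvg0. Qed.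

(** Using [mass_flux] with [la = tau `^ p^-1] and bounding the energy by the
derivative of the moment [Y], the derivative of the mass minus that of a multiple
of [tau `^ p^-1 * Y] is bounded below by a negative multiple of an explicit
power of [tau], up to errors in [1 / n].  Adding primitives of these terms
gives a nondecreasing function [H], and the claim is [H 0 <= H t]. *)
Lemma mass_loss (m : R) : 0 < m -> exists2 A : R, 0 < A & forall r n t,
  0 < r -> 2 * r <= n%:R -> 0 < t -> (t%:E < T)%E ->
  \sum_(x <- vball n) plateau r x * (u x 0 * mu G x) -
    A / r * (t * t `^ p^-1 / n%:R + t `^ p^-1 * phi (t^-1 * m) `^ th) <=
  \sum_(x <- vball n) plateau r x * (u x t * mu G x).
Proof.
move=> m0.
have [Cd Cd0 Hd] := dissipation_le G x0 p1 q0 hpq M0.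
have [Cw Cw0 Hw] := power_sum_decay m0.
have [A0 A00 HA] := mass_flux.
have [b ab Hb] := phi1_decay p1 hpq hLam.
have b0 : 0 < b by have := hpq; lra.
have th1 : 0 < 1 + th by rewrite addr_gt0.
pose be : R := 2 / (1 + th).
have be0 : 0 < be by rewrite divr_gt0.
pose B : R := (1 + be / p) * Cw.
have B0 : 0 < B by rewrite mulr_gt0// addr_gt0// divr_gt0.
(* exponent of the primitive; it is positive because [a < b] *)
pose al : R := p^-1 - th / b.
have al0 : 0 < al.
  rewrite subr_gt0 ltr_pdivrMr// [ltRHS]mulrC ltr_pM2r ?invr_gt0//.
exists (A0 * (2 * Cd + B / al)).
  by apply: mulr_gt0 => //; apply: addr_gt0; [exact: mulr_gt0|exact: divr_gt0].
move=> r n t r0 rn t0 tT.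
have T0 : (0 < T)%E by apply: lt_trans tT; rewrite lte_fin.
have n0' : (0 : R) < n%:R by lra.
have n0 : (0 < n)%N by rewrite -(ltr0n R).
pose Ft (tau : R) := \sum_(x <- vball n) plateau r x * (u x tau * mu G x).
pose Y (tau : R) := moment n (u^~ tau).
pose pw (tau : R) : R := tau `^ p^-1.
pose ph : R := phi (t^-1 * m) `^ th.
have ph0 : 0 <= ph by exact: powR_ge0.
pose k : R := A0 / r.
have k0 : 0 < k by rewrite divr_gt0.
pose k2 : R := 2 * Cd * t `^ p^-1 / n%:R.
pose k3 : R := B * (ph * t `^ (th / b)).
have k30 : 0 <= k3 by apply: mulr_ge0; [exact: ltW|apply: mulr_ge0 => //; exact: powR_ge0].
pose H (tau : R) : R := Ft tau - k * be * (pw tau * Y tau) + k * k2 * tau + k * (k3 / al) * tau `^ al.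
have key : H 0 <= H t.
  apply: derive_ge0_le; first exact: ltW.
    move=> tau tau0 taut.
    have tauT : (tau%:E < T)%E by apply: le_lt_trans tT; rewrite lee_fin.
    have dF := mass_derive n r tau0 tauT.
    have dY := moment_derive n tau0 tauT.
    have dp := is_derive1_powR p^-1 tau0.
    have da := is_derive1_powR al tau0.
    set F' := \sum_(x <- _) _ in dF; set D := dissipation n tau in dY.
    exists (F' - k * be * (pw tau * ((1 + th) * D) + Y tau * (p^-1 * tau `^ (p^-1 - 1))) + k * k2 +
       k * (k3 / al) * (al * tau `^ (al - 1))).
      have -> : H = Ft + (- (k * be)) *: (pw * Y) + (k * k2) *: (id : R -> R) +
          (k * (k3 / al)) *: (fun x : R => x `^ al).
        apply/funext => s.
        rewrite /H -[RHS]/(Ft s + - (k * be) * (pw s * Y s) + k * k2 * s +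
          k * (k3 / al) * s `^ al).
        by ring.
      have dM := @is_deriveM _ _ _ _ _ _ _ _ dp dY.
      apply: is_derive_eq.
      by rewrite /GRing.scale/= -/(Y tau) -/(pw tau); ring.
    have L1 : l1_le G M (u^~ tau) by move=> s us; apply: hM => //; exact: ltW.
    have Dd := Hd n _ n0 L1; rewrite -/(dissipation n tau) -/D in Dd.
    have pw0 : 0 < pw tau by exact: powR_gt0.
    have FA := HA r n (pw tau) (u^~ tau) r0 rn pw0; rewrite -/F' -/k in FA.
    have Wd := Hw n _ tau0 tauT.
    have YW := moment_le_power_sum tau n0.
    have E0 := cutoff_energy_ge0 G x0 p q n (u^~ tau).
    rewrite -/(power_sum n tau) in FA.
    move: FA Wd YW E0 Dd; rewrite -/(Y tau); set W := power_sum _ _.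
    set E := energy _ _ => FA Wd YW E0 Dd.
    have pwp : pw tau `^ (1 - p) = tau `^ (p^-1 - 1).
      by rewrite /pw -powRrM; congr (_ `^ _); field; rewrite gt_eqF.
    (* the decay scale at time [tau], compared with that at the final time *)
    have phd : phi (tau^-1 * m) `^ th <= ph * t `^ (th / b) * tau `^ (- (th / b)).
      have phtau0 := (@phi1P _ _ _ _ p1 hpq hLam (tau^-1 * m) (mulr_gt0 (eqbRL (invr_gt0 tau) tau0) m0)).1.
      have pht0 := (@phi1P _ _ _ _ p1 hpq hLam (t^-1 * m) (mulr_gt0 (eqbRL (invr_gt0 t) t0) m0)).1.
      apply: (@le_trans _ _ (((t / tau) `^ b^-1 * phi (t^-1 * m)) `^ th)).
        by rewrite ge0_ler_powR ?nnegrE ?(ltW th0) ?mulr_ge0 ?powR_ge0 ?(ltW phtau0) ?(ltW pht0) ?Hb.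
      rewrite powRM ?powR_ge0 ?(ltW pht0)// -powRrM -/ph (mulrC b^-1).
      rewrite powRM ?invr_ge0 ?(ltW t0) ?(ltW tau0)//.
      rewrite -[tau^-1]powR_inv1 ?(ltW tau0)// -powRrM mulN1r.
      by rewrite le_eqVlt; apply/orP; left; apply/eqP; ring.
    have tp : 0 < tau `^ (p^-1 - 1) by exact: powR_gt0.
    have tE : tau `^ (p^-1 - 1) * tau `^ (- (th / b)) = tau `^ (al - 1).
      by rewrite -powRD ?(gt_eqF tau0) ?implybT//; congr (_ `^ _); rewrite /al; ring.
    have pwt : pw tau <= t `^ p^-1.
      by rewrite ge0_ler_powR ?nnegrE ?invr_ge0 ?(ltW p0) ?(ltW tau0) ?(ltW t0).
    have WB : tau `^ (p^-1 - 1) * ((1 + be / p) * W) <= k3 * tau `^ (al - 1).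
      rewrite /k3 -tE.
      have -> : B * (ph * t `^ (th / b)) * (tau `^ (p^-1 - 1) * tau `^ (- (th / b))) =
        tau `^ (p^-1 - 1) * ((1 + be / p) * (Cw * (ph * t `^ (th / b) * tau `^ (- (th / b))))).
        by rewrite /B; ring.
      rewrite ler_pM2l// ler_pM2l; last by rewrite addr_gt0// divr_gt0.
      by apply: (le_trans Wd); rewrite ler_pM2l.
    have e1 : pw tau * E <= pw tau * (2 * (Cd / n%:R) - 2 * D).
      by rewrite ler_pM2l//; lra.
    have e2 : pw tau * (2 * (Cd / n%:R)) <= k2.
      rewrite (_ : k2 = t `^ p^-1 * (2 * (Cd / n%:R))); last by rewrite /k2; ring.
      by rewrite ler_wpM2r// mulr_ge0// divr_ge0 ?(ltW Cd0).
    have e3 : tau `^ (p^-1 - 1) * (be / p * Y tau) <= tau `^ (p^-1 - 1) * (be / p * W).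
      by rewrite ler_pM2l// ler_pM2l// divr_gt0.
    have e4 : 0 <= - (pw tau * E + tau `^ (p^-1 - 1) * W) -
       be * (pw tau * ((1 + th) * D) + Y tau * (p^-1 * tau `^ (p^-1 - 1))) + k2 + k3 * tau `^ (al - 1).
      have -> : be * (pw tau * ((1 + th) * D) + Y tau * (p^-1 * tau `^ (p^-1 - 1))) =
         pw tau * (2 * D) + tau `^ (p^-1 - 1) * (be / p * Y tau).
        have beE : be * (1 + th) = 2 by rewrite /be divfK// gt_eqF.
        transitivity (pw tau * (be * (1 + th) * D) + tau `^ (p^-1 - 1) * (be / p * Y tau)).
          by ring.
        by rewrite beE.
      move: e1 e2 e3 WB; rewrite !mulrDl !mulrDr mul1r; lra.
    have := mulr_ge0 (ltW k0) e4.
    have -> : k * (k3 / al) * (al * tau `^ (al - 1)) = k * (k3 * tau `^ (al - 1)).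
      by field; rewrite gt_eqF.
    move: FA; rewrite pwp; lra.
  apply: cvgD; first apply: cvgD; first apply: cvgB.
  - exact: mass_cvg0.
  - apply: cvgM; first exact: cvg_cst.
    by apply: cvgM; [apply: powR_cvg0_right; rewrite invr_gt0|exact: moment_cvg0].
  - by apply: cvgM; [exact: cvg_cst|apply: cvg_within_filter; exact: cvg_id].
  - by apply: cvgM; [exact: cvg_cst|exact: powR_cvg0_right].
move: key; rewrite /H /pw (powR0 (x := p^-1)) ?invr_eq0 ?gt_eqF// (powR0 (x := al)) ?gt_eqF//.
rewrite mul0r !mulr0 subr0 !addr0 -/(Ft 0) -/(Ft t) => key.
have Yt : 0 <= k * be * (t `^ p^-1 * Y t).
  apply: mulr_ge0; first by apply: mulr_ge0; exact: ltW.
  by apply: mulr_ge0; [exact: powR_ge0|exact: cutoff_moment_ge0].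
have tpe : t `^ (th / b) * t `^ al = t `^ p^-1.
  by rewrite -powRD ?(gt_eqF t0) ?implybT//; congr (_ `^ _); rewrite /al; ring.
have k3E : k3 / al * t `^ al = B / al * (t `^ p^-1 * ph).
  by rewrite /k3 -tpe; ring.
have k2E : k2 * t = 2 * Cd * (t * t `^ p^-1 / n%:R) by rewrite /k2; ring.
set S1 := t * t `^ p^-1 / n%:R; set S2 := t `^ p^-1 * _.
have S10 : 0 <= S1 by rewrite mulr_ge0 ?mulr_ge0 ?powR_ge0 ?(ltW t0) ?invr_ge0.
have S20 : 0 <= S2 by rewrite mulr_ge0 ?powR_ge0.
have up : k * k2 * t + k * (k3 / al) * t `^ al <= A0 * (2 * Cd + B / al) / r * (S1 + S2).
  rewrite -!(mulrA k) k2E k3E -/S1 -/S2 -mulrDr.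
  have -> : A0 * (2 * Cd + B / al) / r * (S1 + S2) = k * ((2 * Cd + B / al) * (S1 + S2)).
    by rewrite /k; ring.
  rewrite ler_pM2l//.
  have BA : 0 < B / al by exact: divr_gt0.
  have := mulr_ge0 (ltW BA) S10; have := mulr_ge0 (ltW Cd0) S20.
  by rewrite mulrDl !mulrDr; lra.
lra.
Qed.

End Evolution.

(** * Lower bound for the mass in large balls *)

Theorem theorem1p8 (R : realType) (V : countType) (G : wgraph R V) (x0 : V)
    (p q : R) (Lam : R -> R)
    (hp : 1 < p) (hq : 0 < q) (hpq : 1 < q * (p - 1))
    (hLam : FK_function p Lam) (hFK : faber_krahn G p Lam)
    (u0 : V -> R) (R0 : R)
    (hu0_l1 : (lnorm G 1 [set: V] u0 < +oo)%E)
    (hu0_ge0 : forall x, 0 <= u0 x)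
    (hu0_neq0 : exists x, u0 x != 0)
    (hu0_supp : [set x | u0 x != 0] `<=` gball G x0 R0)
    (T : \bar R) (hT : (0 < T)%E)
    (u : V -> R -> R) (hu : is_solution G p q T u0 u) :
  let m := fine (lnorm G 1 [set: V] u0) in
  let a := q * (p - 1) - 1 in
  forall eps : R, 0 < eps -> eps < 1 ->
  exists2 c : R, 0 < c &
    forall t r : R, 0 < t -> (t%:E < T)%E ->
      Num.max
        (c / eps * t `^ p^-1 * m `^ (a / p) *
         phi1 p q Lam (t^-1 * m `^ (- a)) `^ (a / p))
        (2 * R0) <= r ->
      ((1 - eps)%:E * lnorm G 1 [set: V] u0
         <= lnorm G 1 (gball G x0 r) (u^~ t))%E.
Proof.
move=> m a eps eps0 eps1.
have lm : lnorm G 1 [set: V] u0 = m%:E.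
  rewrite /m fineK// ge0_fin_numE// lnorm1E.
  by apply: esum_ge0 => x _; rewrite lee_fin mulr_ge0 ?mu_ge0.
have m0 : 0 < m.
  have [x ux] := hu0_neq0.
  have := @sum_le_lnorm1 _ _ G [set: V] u0 [:: x] isT (fun _ _ => I).
  rewrite lm lee_fin big_seq1; apply: lt_le_trans.
  by rewrite mulr_gt0 ?mu_gt0 ?normr_gt0.
have [M M0 hM] := solution_l1_bound hu.
have [A A0 HA] := mass_loss x0 hp hq hpq hLam hFK hu M0 hM (powR_gt0 (- a) m0).
pose th := a / p.
(* the factor [m] turns the absolute loss into a fraction of the mass, and
   [m `^ th] compensates the one in the threshold *)
exists (A / (m * m `^ th)); first by rewrite divr_gt0// mulr_gt0 ?powR_gt0.
move=> t r t0 tT; rewrite ge_max => /andP[hr hR0].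
rewrite -/th in hr HA.
have [ph0 _] := @phi1P _ _ _ _ hp hpq hLam _ (mulr_gt0 (eqbRL (invr_gt0 t) t0) (powR_gt0 (- a) m0)).
have mth0 : 0 < m `^ th by exact: powR_gt0.
set S : R := t `^ p^-1 * phi1 p q Lam (t^-1 * m `^ (- a)) `^ th.
have S0 : 0 < S by rewrite mulr_gt0 ?powR_gt0.
have hr' : A * S / (m * eps) <= r.
  apply: le_trans hr; rewrite le_eqVlt; apply/orP; left; apply/eqP.
  by rewrite /S; field; rewrite !gt_eqF.
have r0 : 0 < r by apply: lt_le_trans hr'; apply: divr_gt0; exact: mulr_gt0.
have loss : A / r * S <= eps * m.
  move: hr'; rewrite ler_pdivrMr ?mulr_gt0// => h.
  rewrite mulrAC ler_pdivrMr// (_ : eps * m * r = r * (m * eps))//; ring.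
rewrite lm -EFinM; apply/lee_addgt0Pr => e e0.
have [n n0 hn] := exists_nat_gt (2 * r + A / r * (t * t `^ p^-1) / e).
have n0' : (0 : R) < n%:R by rewrite ltr0n.
have Q0 : 0 <= A / r * (t * t `^ p^-1) / e.
  rewrite divr_ge0 ?(ltW e0)// mulr_ge0 ?divr_ge0 ?mulr_ge0 ?powR_ge0 ?(ltW A0) ?(ltW r0) ?(ltW t0)//.
have rn : 2 * r <= n%:R by lra.
have small : A / r * (t * t `^ p^-1 / n%:R) <= e.
  rewrite mulrA ler_pdivrMr// [e * _]mulrC -ler_pdivrMr//; lra.
have := HA r n t r0 rn t0 tT; rewrite -/S mulrDr.
have [_ _ _ hu0] := hu.
have us := ball_seq_uniq G x0 n.
have -> : \sum_(x <- ball_seq G x0 n) plateau G x0 r x * (u x 0 * mu G x) = m.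
  apply: EFin_inj; rewrite -lm lnorm1E (esum_seq us); first last.
  - move=> x; rewrite mem_ball_seq => xn.
    have -> : u0 x = 0; last by rewrite normr0 mul0r.
    apply/eqP; apply: contraNT xn => /hu0_supp /= xR.
    have {}xR : (gdist G x x0)%:R <= R0 by exact: xR.
    by rewrite -(ler_nat R); lra.
  - by move=> x; rewrite mulr_ge0 ?mu_ge0.
  congr EFin; apply: eq_bigr => x _; rewrite hu0 ger0_norm//.
  have [->|/hu0_supp/= xR] := eqVneq (u0 x) 0; first by rewrite mul0r mulr0.
  have {}xR : (gdist G x x0)%:R <= R0 by exact: xR.
  by rewrite plateau_eq1 ?mul1r//; lra.
move=> HF.
have up : ((\sum_(x <- ball_seq G x0 n) plateau G x0 r x * (u x t * mu G x))%:E <=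
    lnorm G 1 (gball G x0 r) (u^~ t))%E.
  pose s := [seq x <- ball_seq G x0 n | plateau G x0 r x != 0].
  apply: le_trans (@sum_le_lnorm1 _ _ G (gball G x0 r) (u^~ t) s _ _).
  - rewrite lee_fin /s big_filter [leRHS]big_mkcond/=; apply: ler_sum => x _.
    case: ifPn => [_|]; last by rewrite negbK => /eqP->; rewrite mul0r.
    rewrite mulrA ler_wpM2r ?mu_ge0//; apply: (le_trans (ler_norm _)).
    by rewrite normrM ger0_norm ?plateau_ge0// ler_piMl ?plateau_le1.
  - by rewrite filter_uniq.
  - move=> x; rewrite mem_filter => /andP[/(plateau_neq0 r0) xr _].
    exact: ltW.
rewrite -leeBlDr//.
apply: le_trans up; rewrite -EFinB lee_fin; lra.
Qed.
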